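(* Consider a standard protocol (as defined in the context) consisting of $r=r_S+r_L$ rounds, of which $r_S$ are stabilizer measurement rounds and $r_L$ are PSC measurement rounds, let $w_c$ and $w_q$ be the maximum row weight and maximum column weight of the parity check matrix $H$ of the measured stabilizers, and let $\ell$ be the number of tensor factors $V_i$ of the measured transversal PSC $\bar U$. Then any single-qubit circuit-level Pauli error propagates through this protocol to an end-of-circuit Clifford error consisting of $O\big(r^2 w_q(w_c+\ell)\big)$ one- and two-qubit Clifford gates.
   Context: Paulis are tensor products of $I,X,Y,Z$ times a phase in $\{\pm1,\pm i\}$; a Clifford maps Paulis to Paulis under conjugation; a Pauli-Square-Root Clifford (PSC) is a non-Pauli Clifford whose square is a Pauli. For a unitary $U$, $C(U)=|0\rangle\langle0|\otimes I+|1\rangle\langle1|\otimes U$. Setting: data qubits encode a stabilizer code; a subset $S_M=\{g_1,\dots,g_m\}$ of its stabilizers, each $g_i=\bigotimes_j P^{(i)}_j$ a tensor product of single-qubit Paulis, is described by a binary parity check matrix $H$ (rows = elements of $S_M$, columns = qubits, entry 1 iff the stabilizer acts nontrivially on the qubit); $w_c$ is the maximum number of qubits any $g_i$ acts on and $w_q$ the maximum number of $g_i$ acting nontrivially on a single qubit. A transversal logical PSC is $\bar U=\bigotimes_{i=1}^{\ell}V_i$, with the $V_i$ PSCs of pairwise disjoint support, each acting on $O(1)$ qubits, and $\bar U^2=I$. A standard protocol is a circuit consisting of $r$ rounds in an arbitrary order, each either (i) a stabilizer measurement round: for each $g_i$ a fresh ancilla prepared in $|+\rangle$ controls the gates $C(P^{(i)}_j)$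 onto the qubits in the support of $g_i$, or (ii) a PSC measurement round: a fresh ancilla in $|+\rangle$ controls $C(V_i)$ for $i=1,\dots,\ell$; ancillas are never reused and all ancilla measurements (in the $X$ basis) are deferred to the end of the circuit. A circuit-level Pauli error is a Pauli $E$ inserted at some location, i.e. the circuit $W=W_2W_1$ becomes $W_2EW_1$; it propagates to the end-of-circuit error $C_{\mathrm{prop}}=W_2EW_2^{\dagger}$, so that $W_2EW_1=C_{\mathrm{prop}}W$. *)

(* Defs.v *)
From HB Require Import structures.
From mathcomp Require Import all_boot all_order all_algebra algC.
Set Implicit Arguments. Unset Strict Implicit. Unset Printing Implicit Defensive.
Import Order.TTheory GRing.Theory Num.Theory.
Local Open Scope ring_scope.

(* computational basis states of the qubits indexed by the finite type T *)
Definition basis (T : finType) := {ffun T -> bool}.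

(* operators on the qubits T: matrix entries <x|A|y> *)
Definition op (T : finType) := basis T -> basis T -> algC.
Definition state (T : finType) := basis T -> algC.

Definition idop (T : finType) : op T := fun x y => (x == y)%:R.
Definition mulop (T : finType) (A B : op T) : op T :=
  fun x y => \sum_(z : basis T) A x z * B z y.
Definition adj (T : finType) (A : op T) : op T := fun x y => (A y x)^*.
Definition scaleop (T : finType) (c : algC) (A : op T) : op T :=
  fun x y => c * A x y.
Definition apply_op (T : finType) (A : op T) (psi : state T) : state T :=
  fun x => \sum_(y : basis T) A x y * psi y.

(* single-qubit Paulis: 0 = I, 1 = X, 2 = Y, 3 = Z ; entries <a|sigma|b> *)
Definition sigma (k : 'I_4) (a b : bool) : algC :=
  match val k with
  | 0 => (a == b)%:R
  | 1 => (a != b)%:R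
  | 2 => if a == b then 0 else if a then 'i else - 'i
  | _ => if a == b then (if a then -1 else 1) else 0
  end.

Definition pauli_tensor (T : finType) (c : algC) (p : T -> 'I_4) : op T :=
  fun x y => c * \prod_(q : T) sigma (p q) (x q) (y q).

Definition is_pauli (T : finType) (P : op T) : Prop :=
  exists (c : algC) (p : T -> 'I_4), c ^+ 4 = 1 /\ P = pauli_tensor c p.

Definition is_unitary (T : finType) (U : op T) : Prop :=
  mulop U (adj U) = @idop T /\ mulop (adj U) U = @idop T.

Definition is_clifford (T : finType) (U : op T) : Prop :=
  is_unitary U /\
  forall P : op T, is_pauli P -> is_pauli (mulop (mulop U P) (adj U)).

(* Pauli-square-root Clifford: non-Pauli Clifford whose square is a Pauli *)
Definition is_PSC (T : finType) (V : op T) : Prop :=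
  is_clifford V /\ ~ is_pauli V /\ is_pauli (mulop V V).

(* the operator G on qubits S placed on the qubits g s of T (g injective),
   identity on the other qubits of T *)
Definition embed (S T : finType) (g : S -> T) (G : op S) : op T :=
  fun x y => G [ffun s => x (g s)] [ffun s => y (g s)] *
             [forall t, (t \notin codom g) ==> (x t == y t)]%:R.

(* C(G) = |0><0| (x) I + |1><1| (x) G, control qubit c, targets g *)
Definition ctrl (S T : finType) (c : T) (g : S -> T) (G : op S) : op T :=
  fun x y => if x c && y c then embed g G x y
             else if ~~ x c && ~~ y c then (x == y)%:R else 0.

Definition small_clifford_gate (T : finType) (U : op T) : Prop :=
  exists (k : nat) (g : 'I_k -> T) (G : op 'I_k),
    [/\ (k = 1 \/ k = 2)%N, injective g, is_clifford G & U = embed g G].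

(* circuit given by a time-ordered gate list [g1; ...; gT]: gT ... g1 *)
Definition circ (T : finType) (gs : seq (op T)) : op T :=
  foldl (fun acc g => mulop g acc) (@idop T) gs.

Fixpoint all_prop (A : Type) (P : A -> Prop) (s : seq A) : Prop :=
  if s is a :: s' then P a /\ all_prop P s' else True.

Definition single_qubit_pauli (T : finType) (E : op T) : Prop :=
  exists (c : algC) (q0 : T) (a : 'I_4),
    c ^+ 4 = 1 /\ E = pauli_tensor c (fun q => if q == q0 then a else ord0).

Record protocol := Protocol {
  pn : nat;                                   (* number of data qubits *)
  pm : nat;                                   (* |S_M| *)
  pl : nat;                                   (* ell: number of factors V_i *)
  pr : nat;                                   (* number of rounds *)
  pP : 'I_pm -> 'I_pn -> 'I_4;                (* g_i = (x)_j P^(i)_j *)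
  pk : 'I_pl -> nat;                          (* V_i acts on pk i qubits *)
  pf : forall i : 'I_pl, 'I_(pk i) -> 'I_pn;  (* the support of V_i *)
  pV : forall i : 'I_pl, op 'I_(pk i);
  prk : 'I_pr -> bool;        (* true: stabilizer round, false: PSC round *)
  psched : 'I_pr -> seq ('I_pm * 'I_pn);  (* gate order in a stabilizer round *)
  plsched : 'I_pr -> seq 'I_pl }.         (* gate order in a PSC round *)

Arguments pf {_} _ _.
Arguments pV {_} _.
Arguments pk {_} _.
Arguments pP {_} _ _.
Arguments prk {_} _.
Arguments psched {_} _.
Arguments plsched {_} _.

Section Protocol.
Variable P : protocol.

Definition Hmx (i : 'I_(pm P)) (j : 'I_(pn P)) : bool := pP i j != ord0.

Definition wc : nat := \max_(i < pm P) #|[set j | Hmx i j]|.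
Definition wq : nat := \max_(j < pn P) #|[set i | Hmx i j]|.

Definition stab_anc := {x : 'I_(pr P) * 'I_(pm P) | prk x.1}.
Definition psc_anc := {t : 'I_(pr P) | ~~ prk t}.

(* all qubits: data qubits + one fresh ancilla per stabilizer per
   stabilizer round + one fresh ancilla per PSC round *)
Definition qubit : finType := ('I_(pn P) + stab_anc + psc_anc)%type.

Definition data (j : 'I_(pn P)) : qubit := inl (inl j).

Definition gen (i : 'I_(pm P)) : op 'I_(pn P) := pauli_tensor 1 (pP i).

Definition Ubar : op 'I_(pn P) :=
  foldr (fun (i : 'I_(pl P)) acc => mulop (embed (pf i) (pV i)) acc) (@idop _) (enum 'I_(pl P)).

Definition sigma1 (a : 'I_4) : op 'I_1 := fun x y => sigma a (x ord0) (y ord0).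

Definition stab_round_gates (t : 'I_(pr P)) : seq (op qubit) :=
  pmap (fun ij : 'I_(pm P) * 'I_(pn P) =>
          omap (fun a : stab_anc =>
                  ctrl (inl (inr a) : qubit) (fun _ : 'I_1 => data ij.2)
                       (sigma1 (pP ij.1 ij.2)))
               (insub (t, ij.1) : option stab_anc))
       (psched t).

Definition psc_round_gates (t : 'I_(pr P)) : seq (op qubit) :=
  match (insub t : option psc_anc) with
  | Some a => [seq ctrl (inr a : qubit) (fun q => data (pf i q)) (pV i)
              | i <- plsched t]
  | None => [::]
  end.

Definition round_gates (t : 'I_(pr P)) : seq (op qubit) :=
  if prk t then stab_round_gates t else psc_round_gates t.

Definition gates : seq (op qubit) :=
  flatten [seq round_gates t | t <- enum 'I_(pr P)].

Definition in_code (Ss : seq (op 'I_(pn P))) (psi : state 'I_(pn P)) : Prop :=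
  all_prop (fun g => apply_op g psi = psi) Ss.

Definition valid_protocol (s : nat) : Prop :=
  [/\
      forall t, prk t ->
        perm_eq (psched t)
                [seq ij <- enum {: 'I_(pm P) * 'I_(pn P)}
                 | Hmx ij.1 ij.2],
      forall t, ~~ prk t -> perm_eq (plsched t) (enum 'I_(pl P)),
      (* V_i are PSCs on O(1) qubits with pairwise disjoint supports *)
      (forall i : 'I_(pl P), [/\ injective (pf i), is_PSC (pV i) & (pk i <= s)%N]),
      (forall (i i' : 'I_(pl P)) (a : 'I_(pk i)) (b : 'I_(pk i')),
          i != i' -> pf i a != pf i' b) &
      mulop Ubar Ubar = @idop _ /\
      exists Ss : seq (op 'I_(pn P)),
        [/\ all_prop (@is_pauli _) Ss,
            (exists psi, in_code Ss psi /\ psi <> (fun _ => 0)),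
            (forall i, exists sg : algC, (sg = 1 \/ sg = -1) /\
                forall psi, in_code Ss psi ->
                  apply_op (scaleop sg (gen i)) psi = psi) &
            (forall psi, in_code Ss psi -> in_code Ss (apply_op Ubar psi))]].

End Protocol.

(* Main.v *)
From HB Require Import structures.
From mathcomp Require Import all_boot all_algebra algC boolp.
From mathcomp Require Import zify ring.
Require Import Defs.
Set Implicit Arguments. Unset Strict Implicit. Unset Printing Implicit Defensive.
Import GRing.Theory Num.Theory.
Local Open Scope ring_scope.

(** Every gate is controlled by an ancilla and acts on a block of data qubits, a block
    being the support of some [V_i] or a single qubit outside all of them; gates on
    different blocks commute. An error inside a block is therefore affected only by the
    at most [r] gates [C(V_i)] and [O(r w_q)] controlled Paulis of that block.

    Let [m x] be the propagated error on the block when the ancillas are in the basis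
    state [x], starting from a Pauli or from [V] or its inverse. As [V^2] is a Pauli,
    the commutators of Paulis with [V] commute with [V] up to sign, and it follows that
    [V (m x) V^-1 = chi x Q (m x)] for a fixed Pauli [Q] and a character [chi] supported
    on the controls met so far. A controlled Pauli therefore merely conjugates the error
    (a constant number of gates), while [C(V)] multiplies it by a controlled [Q] and at
    most [O(r w_q)] controlled-[Z] gates: [O(r^2 w_q)] gates per block. Keeping the
    controlled Paulis as conjugations, instead of expanding them, is what avoids a second
    factor [w_q].

    A bit flip on the ancilla of a stabilizer leaves at most [w_c] Paulis on data qubits;
    on the ancilla of a PSC round it leaves at most [l] errors [V_i] or [V_i^-1]. Each
    [V_i] is a product of boundedly many gates: a Clifford is a product of rotations
    [(1 + N) / sqrt 2], [N] a Pauli with [N^2 = -1], which play the role of symplectic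
    transvections, and conjugation by rotations on two qubits reduces the weight of
    [N] to at most two. *)

(** * Commutation up to a scalar *)

Section Signs.
Variable R : pzRingType.
Implicit Types e f : R.

Definition is_sign e : Prop := e = 1 \/ e = -1.

Lemma is_sign1 : is_sign 1. Proof. by left. Qed.

Lemma is_signN1 : is_sign (-1). Proof. by right. Qed.

Lemma is_signM e f : is_sign e -> is_sign f -> is_sign (e * f).
Proof.
by case=> -> [] ->; rewrite ?mul1r ?mulN1r ?opprK; [left|right|right|left].
Qed.

Lemma is_sign_sqr e : is_sign e -> e * e = 1.
Proof. by case=> ->; rewrite ?mulrNN mulr1. Qed.

Lemma is_sign_prod (I : Type) (r : seq I) (F : I -> R) :
  (forall i, is_sign (F i)) -> is_sign (\prod_(i <- r) F i).
Proof.
by move=> sF; elim/big_ind: _ => // *; [apply: is_sign1 | apply: is_signM].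
Qed.

Lemma is_sign_signr (b : bool) : is_sign ((-1) ^+ b).
Proof. by case: b; [right; rewrite expr1 | left; rewrite expr0]. Qed.

End Signs.

(* Unlike [scalerAl] and [scalerAr] read from right to left, these keep the products
   in the inferred [algType], where further rewriting can find them. *)
Section ScaledProducts.
Variables (K : pzRingType) (R : algType K).
Implicit Types (k : K) (a b : R).

Lemma scalerMl k a b : (k *: a) * b = k *: (a * b). Proof. by rewrite -scalerAl. Qed.

Lemma scalerMr k a b : a * (k *: b) = k *: (a * b). Proof. by rewrite -scalerAr. Qed.

Lemma commrZ k a b : GRing.comm a b -> GRing.comm a (k *: b).
Proof. by rewrite /GRing.comm scalerMl scalerMr => ->. Qed.

End ScaledProducts.

Section QCommutation.
Variables (K : comNzRingType) (R : algType K).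
Implicit Types (p q k : K) (a b c : R).

Definition qcomm q a b : Prop := a * b = q *: (b * a).

Definition sign_comm a b : Prop := exists2 e, is_sign e & qcomm e a b.

Lemma qcomm1P a b : qcomm 1 a b <-> GRing.comm a b.
Proof. by rewrite /qcomm scale1r. Qed.

Lemma sign_scaleK q a b : is_sign q -> a = q *: b -> b = q *: a.
Proof. by move=> /is_sign_sqr qq ->; rewrite scalerA qq scale1r. Qed.

Lemma qcomm_sym q a b : is_sign q -> qcomm q a b -> qcomm q b a.
Proof. exact: sign_scaleK. Qed.

Lemma qcommMr p q a b c : qcomm p a b -> qcomm q a c -> qcomm (p * q) a (b * c).
Proof.
by rewrite /qcomm => ab ac; rewrite mulrA ab scalerMl -mulrA ac scalerMr scalerA mulrA.
Qed.

Lemma qcommMl p q a b c : qcomm p a c -> qcomm q b c -> qcomm (p * q) (a * b) c.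
Proof.
rewrite /qcomm => ac bc.
by rewrite -mulrA bc scalerMr mulrA ac scalerMl scalerA (mulrC p) mulrA.
Qed.

Lemma qcommZl q k a b : qcomm q a b -> qcomm q (k *: a) b.
Proof. by rewrite /qcomm => ab; rewrite scalerMl ab scalerMr !scalerA mulrC. Qed.

Lemma qcommZr q k a b : qcomm q a b -> qcomm q a (k *: b).
Proof. by rewrite /qcomm => ab; rewrite scalerMl scalerMr ab !scalerA mulrC. Qed.

Lemma qcommN1_comm a b c : qcomm (-1) a b -> qcomm (-1) a c -> GRing.comm a (b * c).
Proof. by move=> ab ac; rewrite -qcomm1P -[1]mulr1 -(mulrNN 1); apply: qcommMr. Qed.

End QCommutation.

(** * Rotations *)

Section RootsOfUnity.
Implicit Types c : algC.

Lemma sqr_i : 'i * 'i = -1 :> algC.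
Proof. by rewrite -expr2 sqrCi. Qed.

Lemma root4_i : 'i ^+ 4 = 1 :> algC.
Proof. by rewrite (exprM _ 2 2) sqrCi sqrrN expr1n. Qed.

Lemma root4_conj c : c ^+ 4 = 1 -> c * c^* = 1.
Proof.
move=> c4; rewrite -normCK; have -> : `|c| = 1; last exact: expr1n.
by apply/eqP; rewrite -(@pexpr_eq1 _ _ 4) // -normrX c4 normr1.
Qed.

Lemma root4_conjX c : c ^+ 4 = 1 -> c^* ^+ 4 = 1.
Proof. by move=> c4; rewrite -rmorphXn c4 rmorph1. Qed.

Lemma root4_sqr c : c ^+ 4 = 1 -> is_sign (c * c).
Proof.
move=> c4; have : (c * c == 1) || (c * c == -1).
  by rewrite -eqf_sqr expr1n -expr2 -exprM c4.
by case/orP=> /eqP ->; [left | right].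
Qed.

Lemma root4P c : c ^+ 4 = 1 -> [\/ c = 1, c = -1 | c * c = -1].
Proof.
move=> /root4_sqr []; last by constructor 3.
by rewrite -expr2 => /eqP; rewrite sqrf_eq1 => /orP [] /eqP ->;
  [constructor 1 | constructor 2].
Qed.

Lemma sqrN1_root4 c : c * c = -1 -> c ^+ 4 = 1.
Proof. by move=> cc; rewrite (exprM c 2 2) [c ^+ 2]expr2 cc sqrrN expr1n. Qed.

Lemma root4_N1 : (-1) ^+ 4 = 1 :> algC.
Proof. by rewrite (exprM _ 2 2) sqrrN !expr1n. Qed.

Lemma sqrtC2V_sqr : (sqrtC 2)^-1 * (sqrtC 2)^-1 = 2^-1 :> algC.
Proof. by rewrite -invfM -expr2 sqrtCK. Qed.

Lemma sqrtC2V_conj : ((sqrtC 2)^-1)^* = (sqrtC 2)^-1 :> algC.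
Proof.
by rewrite fmorphV /= (@conj_Creal _ (sqrtC 2)) // ger0_real // sqrtC_ge0 ler0n.
Qed.

Lemma sqrN1_norm c : c * c = -1 -> (1 + c) * (1 - c) = 2.
Proof. by move=> cc; rewrite mulrC -subr_sqr expr1n expr2 cc opprK. Qed.

Lemma sqrN1_phase_norm c : c * c = -1 ->
  (1 + c) / sqrtC 2 * ((1 + c) / sqrtC 2)^* = 1.
Proof.
move=> cc; have c4 := sqrN1_root4 cc.
have c0 : c != 0 by apply: contra_eq_neq c4 => ->; rewrite expr0n eq_sym oner_eq0.
have -> : ((1 + c) / sqrtC 2)^* = (1 - c) / sqrtC 2.
  rewrite rmorphM /= sqrtC2V_conj rmorphD /= conjC1; congr ((1 + _) / _).
  by apply: (mulfI c0); rewrite root4_conj // mulrN cc opprK.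
by rewrite mulrACA sqrtC2V_sqr sqrN1_norm // mulfV // pnatr_eq0.
Qed.

End RootsOfUnity.

Section Rotations.
Variable R : algType algC.
Implicit Types A B N P : R.

Definition rot N : R := (sqrtC 2)^-1 *: (1 + N).

Lemma half_double A : 2^-1 *: (A + A) = A.
Proof. by rewrite -mulr2n -scaler_nat scalerA mulVf ?scale1r // pnatr_eq0. Qed.

Lemma eq_oppr0 A : A = - A -> A = 0.
Proof. by move=> e; rewrite -[A]half_double {2}e subrr scaler0. Qed.

Lemma rotM N N' : rot N * rot N' = 2^-1 *: ((1 + N) * (1 + N')).
Proof. by rewrite /rot scalerMl scalerMr scalerA sqrtC2V_sqr. Qed.

Lemma rotNK N : N * N = -1 -> rot N * rot (- N) = 1.
Proof.
move=> NN; rewrite rotM mulrDl mul1r mulrDr mulr1 mulrN NN opprK.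
by rewrite addrA subrK half_double.
Qed.

Lemma rot_sqr N : N * N = -1 -> rot N * rot N = N.
Proof.
move=> NN; rewrite rotM mulrDl mul1r mulrDr mulr1 NN.
by rewrite addrC addrA subrK half_double.
Qed.

Lemma comm_rot N A : GRing.comm N A -> GRing.comm (rot N) A.
Proof.
move=> NA; apply: commr_sym; apply: commrZ; apply: commrD; first exact: commr1.
exact: commr_sym.
Qed.

Lemma rot_conj_comm N P : N * N = -1 -> GRing.comm N P ->
  rot N * P * rot (- N) = P.
Proof. by move=> NN /comm_rot ->; rewrite -mulrA rotNK ?mulr1. Qed.

Lemma rot_conj_anti N P : N * N = -1 -> qcomm (-1) N P ->
  rot N * P * rot (- N) = N * P.
Proof.
rewrite /qcomm scaleN1r => NN NP.
have -> : rot N * P * rot (- N) = 2^-1 *: ((1 + N) * P * (1 - N)).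
  by rewrite /rot !scalerMl !scalerMr !scalerA sqrtC2V_sqr.
rewrite mulrDl mul1r NP mulrBr mulr1 mulrBl -mulrA NN mulrN1 opprK opprD.
by rewrite [- (P * N) - P]addrC addrACA subrr add0r -opprD scalerN half_double.
Qed.

Lemma rot_conj_swap e P P' : is_sign e -> P * P = e%:A -> P' * P' = e%:A ->
  qcomm (-1) P P' ->
  let N := e *: (P' * P) in N * N = -1 /\ rot N * P * rot (- N) = P'.
Proof.
move=> se PP PP' anti N; have ee := is_sign_sqr se.
have antiM : qcomm (-1) (P' * P) P.
  rewrite -[-1]mulr1; apply: qcommMl; last by rewrite qcomm1P.
  exact: qcomm_sym (is_signN1 _) anti.
have NN : N * N = -1.
  rewrite /N scalerMl scalerMr scalerA ee scale1r mulrA -(mulrA P') anti.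
  rewrite scaleN1r mulrN mulNr mulrA PP' mulr_algl scalerMl PP.
  by rewrite scalerA ee scale1r.
split=> //; rewrite rot_conj_anti //; last exact: qcommZl.
by rewrite /N scalerMl -mulrA PP mulr_algr scalerA ee scale1r.
Qed.

(* [B] on the eigenspace [-1] of the involution [A] and [1] on its eigenspace [1]. *)
Definition eigen_ctrl A B : R := 2^-1 *: (1 + A) + 2^-1 *: (1 - A) * B.

Lemma eigen_ctrl1 A : eigen_ctrl A 1 = 1.
Proof.
by rewrite /eigen_ctrl mulr1 -scalerDr addrACA subrr addr0 half_double.
Qed.

Lemma eigen_ctrlN1 A : eigen_ctrl A (-1) = A.
Proof.
by rewrite /eigen_ctrl mulrN1 -scalerBr opprB addrC addrA subrK half_double.
Qed.

Lemma eigen_ctrl_qcomm e A B E : qcomm e A E -> GRing.comm B E ->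
  eigen_ctrl A B * E = E * eigen_ctrl (e *: A) B.
Proof.
move=> AE BE; rewrite /eigen_ctrl mulrDl mulrDr !scalerMl !scalerMr.
rewrite -!mulrA BE !(mulrA _ E) mulrDl mulrBl AE mul1r (mulrA E) mulrDr mulrBr.
by rewrite mulr1 !(scalerMl, scalerMr).
Qed.

Lemma eigen_ctrl_phase d A : d * d = -1 ->
  eigen_ctrl A d%:A = ((1 + d) / sqrtC 2) *: rot (- d *: A).
Proof.
move=> dd; rewrite /eigen_ctrl mulr_algr /rot !scalerA -mulrA sqrtC2V_sqr (mulrC d).
rewrite (mulrC (1 + d)) -!scalerA -scalerDr; congr (_ *: _).
rewrite !scalerDr scalerA mulrN mulrDl mul1r dd opprB.
by rewrite !scalerDl !scale1r scalerN scaleNr addrACA.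
Qed.

Lemma eigen_ctrl_rot A B : A * A = 1 -> B * B = 1 -> GRing.comm A B ->
  eigen_ctrl A B = ((1 + 'i) / sqrtC 2) *:
    (rot (- 'i *: A) * rot (- 'i *: B) * rot ('i *: (A * B))).
Proof.
move=> AA BB AB.
have AAB : A * (A * B) = B by rewrite mulrA AA mul1r.
have BAB : B * (A * B) = A by rewrite AB mulrA BB mul1r.
have ABAB : A * B * (A * B) = 1 by rewrite -mulrA BAB AA.
have expand a b c : (1 + a *: A) * (1 + b *: B) * (1 + c *: (A * B)) =
    (1 + a * b * c)%:A + (a + b * c) *: A + (b + a * c) *: B + (c + a * b) *: (A * B).
  rewrite mulrDl mul1r [X in 1 + _ + X]mulrDr mulr1 scalerMl scalerMr scalerA.
  rewrite mulrDr mulr1 scalerMr !mulrDl mul1r !scalerMl AAB BAB ABAB.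
  rewrite !scalerDr !scalerA !scalerDl scale1r (mulrC c a) (mulrC c b) (mulrC c (a * b)).
  by rewrite (AC ((2*2)*(2*2)) ((1*8)*(3*6)*(2*7)*(5*4))).
rewrite /rot !(scalerMl, scalerMr) !scalerA expand !mulrNN !mulNr !sqr_i opprK.
rewrite mulN1r [- 'i + 1]addrC -['i - 1]opprB scaleNr -scalerN -!scalerDr scalerA.
rewrite (_ : _ * (1 - 'i) = 2^-1).
  rewrite /eigen_ctrl scalerMl -scalerDr mulrDl mul1r mulNr; congr (_ *: _).
  by rewrite addrA.
have -> : (1 + 'i) / sqrtC 2 * ((sqrtC 2)^-1 / sqrtC 2 / sqrtC 2) * (1 - 'i) =
    ((1 + 'i) * (1 - 'i)) * ((sqrtC 2)^-1 / sqrtC 2) * ((sqrtC 2)^-1 / sqrtC 2) :> algC.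
  by ring.
by rewrite sqrtC2V_sqr (sqrN1_norm sqr_i) mulfV ?mul1r // pnatr_eq0.
Qed.

End Rotations.

(** * The algebra of operators *)

HB.instance Definition _ (T : finType) := gen_eqMixin (op T).
HB.instance Definition _ (T : finType) := gen_choiceMixin (op T).

Lemma opP (T : finType) (A B : op T) : (forall x y, A x y = B x y) -> A = B.
Proof. by move=> AB; apply/funext => x; apply/funext => y. Qed.

Section OperatorAlgebra.
Variable T : finType.
Implicit Types A B C : op T.

Definition zeroop : op T := fun _ _ => 0.
Definition addop A B : op T := fun x y => A x y + B x y.
Definition oppop A : op T := fun x y => - A x y.

Fact addopA : associative addop.
Proof. by move=> A B C; apply: opP => x y; apply: addrA. Qed.

Fact addopC : commutative addop.
Proof. by move=> A B; apply: opP => x y; apply: addrC. Qed.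

Fact add0op : left_id zeroop addop.
Proof. by move=> A; apply: opP => x y; apply: add0r. Qed.

Fact addNop : left_inverse zeroop oppop addop.
Proof. by move=> A; apply: opP => x y; apply: addNr. Qed.

HB.instance Definition _ :=
  GRing.isZmodule.Build (op T) addopA addopC add0op addNop.

Fact mulopA : associative (@mulop T).
Proof.
move=> A B C; apply: opP => x y; rewrite /mulop.
under eq_bigr do rewrite big_distrr /=.
rewrite exchange_big /=; apply: eq_bigr => z _.
by rewrite big_distrl /=; apply: eq_bigr => u _; rewrite mulrA.
Qed.

Fact mul1op : left_id (@idop T) (@mulop T).
Proof.
move=> A; apply: opP => x y; rewrite /mulop /idop (bigD1 x) //= eqxx mul1r.
by rewrite big1 ?addr0 // => z zx; rewrite eq_sym (negPf zx) mul0r.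
Qed.

Fact mulop1 : right_id (@idop T) (@mulop T).
Proof.
move=> A; apply: opP => x y; rewrite /mulop /idop (bigD1 y) //= eqxx mulr1.
by rewrite big1 ?addr0 // => z zy; rewrite (negPf zy) mulr0.
Qed.

Fact mulopDl : left_distributive (@mulop T) addop.
Proof.
move=> A B C; apply: opP => x y; rewrite /mulop /addop -big_split /=.
by apply: eq_bigr => z _; rewrite mulrDl.
Qed.

Fact mulopDr : right_distributive (@mulop T) addop.
Proof.
move=> A B C; apply: opP => x y; rewrite /mulop /addop -big_split /=.
by apply: eq_bigr => z _; rewrite mulrDr.
Qed.

Fact idop_neq0 : @idop T != zeroop.
Proof.
apply/eqP => /(congr1 (fun A : op T => A [ffun=> true] [ffun=> true])).
by rewrite /idop /zeroop eqxx; apply/eqP; rewrite oner_eq0.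
Qed.

HB.instance Definition _ := GRing.Zmodule_isNzRing.Build (op T)
  mulopA mul1op mulop1 mulopDl mulopDr idop_neq0.

Fact scaleopA a b A : scaleop a (scaleop b A) = scaleop (a * b) A.
Proof. by apply: opP => x y; apply: mulrA. Qed.

Fact scale1op : left_id 1 (@scaleop T).
Proof. by move=> A; apply: opP => x y; apply: mul1r. Qed.

Fact scaleopDr : right_distributive (@scaleop T) +%R.
Proof. by move=> a A B; apply: opP => x y; apply: mulrDr. Qed.

Fact scaleopDl A : {morph (@scaleop T)^~ A : a b / a + b}.
Proof. by move=> a b; apply: opP => x y; apply: mulrDl. Qed.

HB.instance Definition _ := GRing.Zmodule_isLmodule.Build algC (op T)
  scaleopA scale1op scaleopDr scaleopDl.

Fact scaleopAl a A B : scaleop a (mulop A B) = mulop (scaleop a A) B.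
Proof.
apply: opP => x y; rewrite /scaleop /mulop.
by rewrite big_distrr /=; apply: eq_bigr => z _; rewrite mulrA.
Qed.

HB.instance Definition _ := GRing.Lmodule_isLalgebra.Build algC (op T) scaleopAl.

Fact scaleopAr a A B : scaleop a (mulop A B) = mulop A (scaleop a B).
Proof.
apply: opP => x y; rewrite /scaleop /mulop.
by rewrite big_distrr /=; apply: eq_bigr => z _; rewrite mulrCA.
Qed.

HB.instance Definition _ := GRing.Lalgebra_isAlgebra.Build algC (op T) scaleopAr.

Lemma opmE A B x y : (A * B) x y = \sum_z A x z * B z y. Proof. by []. Qed.
Lemma opDE A B x y : (A + B) x y = A x y + B x y. Proof. by []. Qed.
Lemma opNE A x y : (- A) x y = - A x y. Proof. by []. Qed.
Lemma opZE a A x y : (a *: A) x y = a * A x y. Proof. by []. Qed.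
Lemma op1E x y : (1 : op T) x y = (x == y)%:R. Proof. by []. Qed.
Lemma mulopE A B : mulop A B = A * B. Proof. by []. Qed.

Lemma scaler1_inj : injective (fun a : algC => a%:A : op T).
Proof.
move=> a b /(congr1 (fun A : op T => A [ffun=> true] [ffun=> true])).
by rewrite !opZE op1E eqxx !mulr1.
Qed.

Lemma basis_neqP (x y : basis T) : x != y -> exists t, x t != y t.
Proof.
move=> xy; apply/existsP; apply: contraR xy; rewrite negb_exists => /forallP e.
by apply/eqP/ffunP => t; apply/eqP; have := e t; rewrite negbK.
Qed.

End OperatorAlgebra.

Section Unitaries.
Variable T : finType.
Implicit Types A B G N U V : op T.

Lemma adjM A B : adj (A * B) = adj B * adj A.
Proof.
apply: opP => x y; rewrite /adj !opmE rmorph_sum; apply: eq_bigr => z _.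
by rewrite rmorphM mulrC.
Qed.

Lemma adjK : involutive (@adj T).
Proof. by move=> A; apply: opP => x y; rewrite /adj conjCK. Qed.

Lemma adjD A B : adj (A + B) = adj A + adj B.
Proof. by apply: opP => x y; rewrite /adj !opDE rmorphD. Qed.

Lemma adjZ a A : adj (a *: A) = a^* *: adj A.
Proof. by apply: opP => x y; rewrite /adj !opZE rmorphM. Qed.

Lemma adj1 : adj (1 : op T) = 1.
Proof. by apply: opP => x y; rewrite /adj !op1E conjC_nat eq_sym. Qed.

Lemma unitary_mulVr U : is_unitary U -> adj U * U = 1. Proof. by case. Qed.

Lemma unitary_mulrV U : is_unitary U -> U * adj U = 1. Proof. by case. Qed.

Lemma unitary_mulKr U A : is_unitary U -> adj U * (U * A) = A.
Proof. by move=> uU; rewrite mulrA unitary_mulVr // mul1r. Qed.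

Lemma unitaryM U V : is_unitary U -> is_unitary V -> is_unitary (U * V).
Proof.
move=> uU uV; split; rewrite !mulopE adjM.
  by rewrite mulrA -(mulrA U) unitary_mulrV // mulr1 unitary_mulrV.
by rewrite -mulrA unitary_mulKr // unitary_mulVr.
Qed.

Lemma unitary1 : is_unitary (1 : op T).
Proof. by split; rewrite mulopE adj1 mulr1. Qed.

Lemma unitaryZ a U : a * a^* = 1 -> is_unitary U -> is_unitary (a *: U).
Proof.
move=> aa uU; split; rewrite mulopE adjZ scalerMl scalerMr scalerA.
  by rewrite unitary_mulrV // aa scale1r.
by rewrite unitary_mulVr // mulrC aa scale1r.
Qed.

Lemma unitary_neq0 U : is_unitary U -> U <> 0.
Proof.
by case=> UU _ U0; move/eqP: UU; rewrite mulopE U0 mul0r eq_sym oner_eq0.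
Qed.

Lemma unitary_comm_anti U V : is_unitary U -> is_unitary V ->
  GRing.comm U V -> qcomm (-1) U V -> False.
Proof.
move=> uU uV UV anti; apply: (unitary_neq0 (unitaryM uU uV)).
by apply: eq_oppr0; rewrite [LHS]anti scaleN1r UV.
Qed.

Lemma unitary_scalar_norm a : is_unitary (a%:A : op T) -> a * a^* = 1.
Proof.
move=> /unitary_mulrV; rewrite adjZ adj1 scalerMl scalerMr mulr1 scalerA => aa.
by apply: (@scaler1_inj T); rewrite aa scale1r.
Qed.

Lemma qcomm_adj e U A : is_unitary U -> is_sign e -> qcomm e U A -> qcomm e (adj U) A.
Proof.
move=> uU se UA; rewrite /qcomm -[LHS]mulr1 -(unitary_mulrV uU) !mulrA.
rewrite -[adj U * A * U]mulrA (qcomm_sym se UA) scalerMr scalerMl.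
by rewrite mulrA unitary_mulVr // mul1r.
Qed.

Definition conj_by G A : op T := G * A * adj G.

Lemma conj_by1 A : conj_by 1 A = A.
Proof. by rewrite /conj_by adj1 mulr1 mul1r. Qed.

Lemma conj_byMl G H A : conj_by (G * H) A = conj_by G (conj_by H A).
Proof. by rewrite /conj_by adjM !mulrA. Qed.

Lemma conj_byMr G A B : is_unitary G -> conj_by G (A * B) = conj_by G A * conj_by G B.
Proof.
by move=> uG; rewrite /conj_by -!mulrA unitary_mulKr.
Qed.

Lemma conj_byD G A B : conj_by G (A + B) = conj_by G A + conj_by G B.
Proof. by rewrite /conj_by mulrDr mulrDl. Qed.

Lemma conj_byZ G a A : conj_by G (a *: A) = a *: conj_by G A.
Proof. by rewrite /conj_by scalerMr scalerMl. Qed.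

Lemma conj_by_one G : is_unitary G -> conj_by G 1 = 1.
Proof. by move=> uG; rewrite /conj_by mulr1 unitary_mulrV. Qed.

Lemma conj_byK G : is_unitary G -> cancel (conj_by G) (conj_by (adj G)).
Proof.
move=> uG A; rewrite /conj_by adjK !mulrA unitary_mulVr // mul1r.
by rewrite -mulrA unitary_mulVr // mulr1.
Qed.

Lemma conj_by_qcomm e G A : is_unitary G -> qcomm e G A -> conj_by G A = e *: A.
Proof. by move=> uG GA; rewrite /conj_by GA scalerMl -mulrA unitary_mulrV // mulr1. Qed.

Lemma conj_by_comm G A : is_unitary G -> GRing.comm G A -> conj_by G A = A.
Proof. by move=> uG; rewrite -qcomm1P => /conj_by_qcomm ->; rewrite ?scale1r. Qed.

Lemma qcomm_conj_byP e G A : is_unitary G -> conj_by G A = e *: A -> qcomm e G A.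
Proof.
by move=> uG GA; rewrite /qcomm -scalerMl -GA -(mulrA (G * A)) unitary_mulVr ?mulr1.
Qed.

Lemma qcomm_conj_by e G A B : is_unitary G -> qcomm e A B ->
  qcomm e (conj_by G A) (conj_by G B).
Proof. by move=> uG AB; rewrite /qcomm -!conj_byMr // AB conj_byZ. Qed.

Lemma qcomm_conj_byl e q G A B : is_unitary G -> is_sign e ->
  qcomm e G B -> qcomm q A B -> qcomm q (conj_by G A) B.
Proof.
move=> uG se GB AB; rewrite -[q](_ : e * q * e = q) => [|]; last first.
  by rewrite mulrAC is_sign_sqr ?mul1r.
by apply: qcommMl; [apply: qcommMl | apply: qcomm_adj].
Qed.

Lemma unitary_sqrN1_adj N : is_unitary N -> N * N = -1 -> adj N = - N.
Proof. by move=> uN NN; rewrite -[LHS]mulr1 -[1]opprK -NN mulrN unitary_mulKr. Qed.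

Lemma rot_adj N : is_unitary N -> N * N = -1 -> adj (rot N) = rot (- N).
Proof.
by move=> uN NN; rewrite /rot adjZ adjD adj1 unitary_sqrN1_adj // sqrtC2V_conj.
Qed.

Lemma conj_by_rot G N : is_unitary G -> conj_by G (rot N) = rot (conj_by G N).
Proof. by move=> uG; rewrite /rot conj_byZ conj_byD conj_by_one. Qed.

End Unitaries.

Section Circuits.
Variable T : finType.
Implicit Types (A : op T) (gs : seq (op T)).

Lemma circ_nil : circ [::] = 1 :> op T. Proof. by []. Qed.

Lemma circ_rcons gs A : circ (rcons gs A) = A * circ gs.
Proof. by rewrite /circ foldl_rcons. Qed.

Lemma circ_cons A gs : circ (A :: gs) = circ gs * A.
Proof.
elim/last_ind: gs => [|gs B IH]; first by rewrite /circ /= mulopE mulr1 mul1r.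
by rewrite -rcons_cons !circ_rcons IH mulrA.
Qed.

Lemma circ_unitary (L : Type) (gate : L -> op T) s :
  (forall l, is_unitary (gate l)) -> is_unitary (circ (map gate s)).
Proof.
move=> ug; elim: s => [|l s IH] /=; first exact: unitary1.
by rewrite circ_cons; apply: unitaryM.
Qed.

End Circuits.

(** * Pauli operators *)

Definition letterX : 'I_4 := @Ordinal 4 1 isT.
Definition letterY : 'I_4 := @Ordinal 4 2 isT.
Definition letterZ : 'I_4 := @Ordinal 4 3 isT.

Section Letters.
Implicit Types a b e f : 'I_4.

Variant letter_spec : 'I_4 -> Type :=
  | LetterI : letter_spec ord0
  | LetterX : letter_spec letterX
  | LetterY : letter_spec letterY
  | LetterZ : letter_spec letterZ.

Lemma letterP a : letter_spec a.
Proof.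
case: a => [[|[|[|[|//]]]] p].
- by rewrite (_ : Ordinal p = ord0); [constructor | apply: val_inj].
- by rewrite (_ : Ordinal p = letterX); [constructor | apply: val_inj].
- by rewrite (_ : Ordinal p = letterY); [constructor | apply: val_inj].
- by rewrite (_ : Ordinal p = letterZ); [constructor | apply: val_inj].
Qed.

Definition letter_mul a b : 'I_4 :=
  match val a, val b with
  | 0, _ => b | _, 0 => a
  | 1, 1 | 2, 2 | 3, _.+3 => ord0
  | 1, 2 | 2, 1 => letterZ
  | 1, _ | _, 1 => letterY
  | _, _ => letterX
  end.

Definition letter_phase a b : algC :=
  match val a, val b with
  | 1, 2 | 2, 3 | 3, 1 => 'i
  | 2, 1 | 3, 2 | 1, 3 => - 'i
  | _, _ => 1
  end.

Definition letter_anti a b : bool := [&& a != ord0, b != ord0 & a != b].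

Lemma sigmaM a b x y :
  \sum_z sigma a x z * sigma b z y = letter_phase a b * sigma (letter_mul a b) x y.
Proof.
rewrite big_bool /=.
by case: (letterP a); case: (letterP b); case: x; case: y;
  rewrite /sigma /letter_phase /= ?(mulr0, mul0r, mulr1, mul1r, addr0, add0r, mulrN,
    mulNr, sqr_i, opprK, mulrN1, mulN1r, opprK).
Qed.

Lemma sigma_conj a x y : (sigma a x y)^* = sigma a y x.
Proof.
by case: (letterP a); case: x; case: y; rewrite /sigma /=
  ?rmorphN /= ?(conjCi, conjC_nat, conjC1, conjC0) ?opprK.
Qed.

Lemma sigma_diag a x y : (a == ord0) || (a == letterZ) -> x != y -> sigma a x y = 0.
Proof. by case: (letterP a) => // _; case: x; case: y. Qed.

Lemma letter_phase_root4 a b : letter_phase a b ^+ 4 = 1.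
Proof.
case: (letterP a); case: (letterP b);
  by rewrite /letter_phase /= ?expr1n // ?(exprM _ 2 2) ?sqrrN ?sqrCi ?sqrrN ?expr1n.
Qed.

Lemma letter_phaseC a b : letter_phase a b = (-1) ^+ letter_anti a b * letter_phase b a.
Proof.
by case: (letterP a); case: (letterP b);
  rewrite /letter_anti /letter_phase /= ?expr0 ?expr1 ?mul1r ?mulN1r ?opprK.
Qed.

Lemma letter_phaseaa a : letter_phase a a = 1. Proof. by case: (letterP a). Qed.

Lemma letter_phase0r a : letter_phase ord0 a = 1. Proof. by []. Qed.

Lemma letter_phaser0 a : letter_phase a ord0 = 1. Proof. by case: (letterP a). Qed.

Lemma letter_mulC a b : letter_mul a b = letter_mul b a.
Proof. by case: (letterP a); case: (letterP b). Qed.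

Lemma letter_mulaa a : letter_mul a a = ord0. Proof. by case: (letterP a). Qed.

Lemma letter_mulr0 a : letter_mul a ord0 = a.
Proof. by apply/val_inj; case: (letterP a). Qed.

Lemma letter_antiaa a : letter_anti a a = false.
Proof. by rewrite /letter_anti eqxx !andbF. Qed.

Lemma letter_antir0 a : letter_anti a ord0 = false.
Proof. by rewrite /letter_anti eqxx andbF. Qed.

Lemma common_anti_letter a b : a != ord0 -> b != ord0 ->
  exists e, letter_anti a e && letter_anti b e.
Proof.
move=> a0 b0; exists (if a != b then letter_mul a b else
                      if a == letterX then letterZ else letterX).
by move: a0 b0; case: (letterP a); case: (letterP b).
Qed.

End Letters.

Section PauliTensors.
Variable T : finType.
Implicit Types (a b t : T) (e f : 'I_4) (p q : T -> 'I_4) (P Q U : op T).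

Lemma pauli_tensorE c p x y : pauli_tensor c p x y = c * \prod_t sigma (p t) (x t) (y t).
Proof. by []. Qed.

Lemma eq_pauli_tensor c p q : p =1 q -> pauli_tensor c p = pauli_tensor c q.
Proof. by move=> pq; congr pauli_tensor; apply/funext. Qed.

Definition pauli_phase p q : algC := \prod_t letter_phase (p t) (q t).
Definition pauli_sign p q : algC := \prod_t (-1) ^+ letter_anti (p t) (q t).

Lemma pauli_phase_root4 p q : pauli_phase p q ^+ 4 = 1.
Proof. by rewrite -prodrXl big1 // => t _; rewrite letter_phase_root4. Qed.

Lemma is_sign_pauli_sign p q : is_sign (pauli_sign p q).
Proof. by apply: is_sign_prod => t; apply: is_sign_signr. Qed.

Lemma pauli_tensorM c d p q : pauli_tensor c p * pauli_tensor d q =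
  pauli_tensor (c * d * pauli_phase p q) (fun t => letter_mul (p t) (q t)).
Proof.
apply: opP => x y; rewrite opmE; under eq_bigr do rewrite !pauli_tensorE.
rewrite pauli_tensorE; under eq_bigr do rewrite mulrACA -big_split /=.
rewrite -big_distrr /= -mulrA; congr (_ * _); rewrite -big_split /=.
have := bigA_distr_bigA (fun t z => sigma (p t) (x t) z * sigma (q t) z (y t)).
by move=> /= <-; apply: eq_bigr => t _; apply: sigmaM.
Qed.

Lemma pauli_tensorM_disjoint c d p q : (forall t, p t = ord0 \/ q t = ord0) ->
  pauli_tensor c p * pauli_tensor d q =
  pauli_tensor (c * d) (fun t => letter_mul (p t) (q t)).
Proof.
move=> pq; rewrite pauli_tensorM /pauli_phase big1 ?mulr1 // => t _.
by case: (pq t) => ->; rewrite ?letter_phase0r ?letter_phaser0.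
Qed.

Lemma pauli_tensorZ k c p : k *: pauli_tensor c p = pauli_tensor (k * c) p.
Proof. by apply: opP => x y; rewrite opZE !pauli_tensorE mulrA. Qed.

Lemma pauli_tensor_adj c p : adj (pauli_tensor c p) = pauli_tensor c^* p.
Proof.
apply: opP => x y; rewrite /adj !pauli_tensorE rmorphM rmorph_prod.
by congr (_ * _); apply: eq_bigr => t _; rewrite /= sigma_conj.
Qed.

Lemma pauli_tensor0 c : pauli_tensor c (fun=> ord0) = c%:A :> op T.
Proof.
apply: opP => x y; rewrite opZE op1E pauli_tensorE; congr (_ * _).
have [->|/basis_neqP [t xyt]] := eqVneq x y.
  by rewrite big1 // => t _; rewrite /sigma eqxx.
by rewrite (bigD1 t) //= sigma_diag ?mul0r.
Qed.

Lemma pauli_tensor_qcomm c d p q :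
  qcomm (pauli_sign p q) (pauli_tensor c p) (pauli_tensor d q).
Proof.
rewrite /qcomm !pauli_tensorM pauli_tensorZ.
have -> : pauli_phase p q = pauli_sign p q * pauli_phase q p.
  by rewrite -big_split /=; apply: eq_bigr => t _; apply: letter_phaseC.
rewrite mulrCA (mulrC c d).
by apply: eq_pauli_tensor => t; apply: letter_mulC.
Qed.

Lemma pauli_tensor_sqr c p : pauli_tensor c p * pauli_tensor c p = (c * c)%:A.
Proof.
rewrite -pauli_tensor0 pauli_tensorM /pauli_phase big1 ?mulr1 => [|t _].
  by apply: eq_pauli_tensor => t; apply: letter_mulaa.
exact: letter_phaseaa.
Qed.

Lemma pauli_sign_single p q a : (forall t, t != a -> ~~ letter_anti (p t) (q t)) ->
  pauli_sign p q = (-1) ^+ letter_anti (p a) (q a).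
Proof.
move=> anti; rewrite /pauli_sign (bigD1 a) //= big1 ?mulr1 // => t /anti /negPf ->.
by rewrite expr0.
Qed.

Definition site_letter a e : T -> 'I_4 := fun t => if t == a then e else ord0.

Definition pauli_at a e : op T := pauli_tensor 1 (site_letter a e).

Lemma pauli_at_adj a e : adj (pauli_at a e) = pauli_at a e.
Proof. by rewrite pauli_tensor_adj rmorph1. Qed.

Lemma pauli_at_sqr a e : pauli_at a e * pauli_at a e = 1.
Proof. by rewrite pauli_tensor_sqr mul1r scale1r. Qed.

Lemma pauli_at0 a : pauli_at a ord0 = 1.
Proof.
rewrite -[RHS](scale1r 1) -pauli_tensor0; apply: eq_pauli_tensor => t.
by rewrite /site_letter if_same.
Qed.

Lemma pauli_atY a : pauli_at a letterY = 'i *: (pauli_at a letterX * pauli_at a letterZ).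
Proof.
rewrite pauli_tensorM pauli_tensorZ /pauli_phase (bigD1 a) //= big1 => [|t ta].
  rewrite /site_letter eqxx /letter_phase /= !mulr1 mul1r mulrN sqr_i opprK.
  by apply: eq_pauli_tensor => t; rewrite /site_letter; case: ifP.
by rewrite /site_letter (negPf ta).
Qed.

Lemma pauli_tensor_at_qcomm c p a e :
  qcomm ((-1) ^+ letter_anti (p a) e) (pauli_tensor c p) (pauli_at a e).
Proof.
have -> : (-1) ^+ letter_anti (p a) e = pauli_sign p (site_letter a e).
  rewrite (@pauli_sign_single _ _ a) /site_letter ?eqxx // => t /negPf ->.
  by rewrite letter_antir0.
exact: pauli_tensor_qcomm.
Qed.

Lemma pauli_at_qcomm a b e f :
  qcomm ((-1) ^+ ((a == b) && letter_anti e f)) (pauli_at a e) (pauli_at b f).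
Proof.
have := pauli_tensor_at_qcomm 1 (site_letter a e) b f.
by rewrite /site_letter eq_sym; case: eqP.
Qed.

Lemma pauli_at_anti a e f : letter_anti e f ->
  qcomm (-1) (pauli_at a e) (pauli_at a f).
Proof. by move=> ef; have := pauli_at_qcomm a a e f; rewrite eqxx ef. Qed.

Lemma pauli_at_comm a b e f : a != b -> GRing.comm (pauli_at a e) (pauli_at b f).
Proof. by move=> /negPf ab; have := pauli_at_qcomm a b e f; rewrite ab qcomm1P. Qed.

Lemma pauli_tensor_prod c p : pauli_tensor c p = c *: \prod_t pauli_at t (p t).
Proof.
suff prod_seq r : uniq r -> \prod_(t <- r) pauli_at t (p t) =
    pauli_tensor 1 (fun t => if t \in r then p t else ord0).
  rewrite prod_seq ?index_enum_uniq // pauli_tensorZ mulr1.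
  by apply: eq_pauli_tensor => t; rewrite mem_index_enum.
elim: r => [_|a r IH /= /andP [ar /IH {}IH]].
  by rewrite big_nil pauli_tensor0 scale1r.
rewrite big_cons IH pauli_tensorM_disjoint ?mulr1 => [|t].
  apply: eq_pauli_tensor => t; rewrite inE /site_letter.
  by case: eqP => [->|]; rewrite ?(negPf ar) ?letter_mulr0.
by rewrite /site_letter; case: eqP => [->|]; [rewrite (negPf ar); right | left].
Qed.

Lemma pauli_atZE a x y : pauli_at a letterZ x y = (-1) ^+ x a * (x == y)%:R.
Proof.
rewrite /pauli_at pauli_tensorE mul1r; have [<-|/basis_neqP [t xyt]] := eqVneq x y.
  rewrite mulr1 (bigD1 a) //= /site_letter eqxx big1 ?mulr1 => [|t /negPf ->].
    by rewrite /sigma /= eqxx; case: (x a).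
  by rewrite /sigma eqxx.
by rewrite mulr0 (bigD1 t) //= sigma_diag ?mul0r // /site_letter; case: ifP.
Qed.

End PauliTensors.

Section PauliGroup.
Variable T : finType.
Implicit Types (P Q : op T) (p q : T -> 'I_4).

Lemma pauliM P Q : is_pauli P -> is_pauli Q -> is_pauli (P * Q).
Proof.
move=> [c [p [c4 ->]]] [d [q [d4 ->]]]; rewrite pauli_tensorM.
by do 2!eexists; split; last reflexivity; rewrite !exprMn c4 d4 pauli_phase_root4 !mul1r.
Qed.

Lemma pauli_at_pauli a e : is_pauli (pauli_at a e : op T).
Proof. by exists 1, (site_letter a e); rewrite expr1n. Qed.

Lemma pauli1 : is_pauli (1 : op T).
Proof. by exists 1, (fun=> ord0); rewrite expr1n pauli_tensor0 scale1r. Qed.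

Lemma pauli_adj P : is_pauli P -> is_pauli (adj P).
Proof.
move=> [c [p [c4 ->]]]; exists c^*, p; rewrite pauli_tensor_adj; split=> //.
exact: root4_conjX.
Qed.

Lemma pauli_unitary P : is_pauli P -> is_unitary P.
Proof.
move=> [c [p [c4 ->]]]; have -> : pauli_tensor c p = c *: pauli_tensor 1 p.
  by rewrite pauli_tensorZ mulr1.
apply: unitaryZ; first exact: root4_conj.
by split; rewrite mulopE pauli_tensor_adj rmorph1 pauli_tensor_sqr mulr1 scale1r.
Qed.

Lemma pauli_sign_comm P Q : is_pauli P -> is_pauli Q -> sign_comm P Q.
Proof.
move=> [c [p [c4 ->]]] [d [q [d4 ->]]]; exists (pauli_sign p q).
  exact: is_sign_pauli_sign.
exact: pauli_tensor_qcomm.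
Qed.

Lemma pauli_sqr P : is_pauli P -> exists2 e, is_sign e & P * P = e%:A.
Proof.
move=> [c [p [c4 ->]]]; exists (c * c); last exact: pauli_tensor_sqr.
exact: root4_sqr.
Qed.

Lemma pauli_adjE P : is_pauli P -> exists2 e, is_sign e & adj P = e *: P.
Proof.
move=> pP; have [e se PP] := pauli_sqr pP; exists e => //.
apply: sign_scaleK => //.
by rewrite -[LHS](unitary_mulKr _ (pauli_unitary pP)) PP scalerMr mulr1.
Qed.

Lemma pauli_anti_letter c d p q : is_pauli (pauli_tensor c p : op T) ->
  is_pauli (pauli_tensor d q : op T) ->
  qcomm (-1) (pauli_tensor c p) (pauli_tensor d q) -> exists t, letter_anti (p t) (q t).
Proof.
move=> pP pQ anti; case: (pickP (fun t => letter_anti (p t) (q t))) => [t|comm].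
  by exists t.
case: (unitary_comm_anti (pauli_unitary pP) (pauli_unitary pQ) _ anti).
rewrite -qcomm1P; have := pauli_tensor_qcomm c d p q.
by rewrite /pauli_sign big1 // => t _; rewrite (comm t : letter_anti _ _ = false).
Qed.

Lemma pauli_anti_at c p a e : is_pauli (pauli_tensor c p : op T) ->
  qcomm (-1) (pauli_tensor c p) (pauli_at a e) -> letter_anti (p a) e.
Proof.
move=> pP anti; have [t] := pauli_anti_letter pP (pauli_at_pauli a e) anti.
by rewrite /site_letter; case: eqP => [->|]; rewrite ?letter_antir0.
Qed.

End PauliGroup.

Section PauliCentralizer.
Variable T : finType.
Implicit Types (U : op T) (x y u : basis T).

Lemma comm_pauliZ_offdiag U t x y : GRing.comm U (pauli_at t letterZ) ->
  x t != y t -> U x y = 0.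
Proof.
move=> UZ xyt; have /(congr1 (fun A : op T => A x y)) := UZ.
rewrite opmE (bigD1 y) //= pauli_atZE eqxx mulr1 big1 => [|z zy]; last first.
  by rewrite pauli_atZE (negPf zy) !mulr0.
rewrite opmE (bigD1 x) //= pauli_atZE eqxx mulr1 big1 => [|z zx]; last first.
  by rewrite pauli_atZE eq_sym (negPf zx) mulr0 mul0r.
rewrite !addr0; move: xyt.
case: (x t); case: (y t) => // _; rewrite ?expr0 ?expr1 ?mulr1 ?mul1r ?mulrN1 ?mulN1r;
  move=> /eqP; rewrite ?[- U x y == _]eq_sym -addr_eq0 -mulr2n mulrn_eq0 => /eqP //.
Qed.

Definition flip u : op T := pauli_tensor 1 (fun t => if u t then letterX else ord0).

Lemma flipE u x y : flip u x y = (y == [ffun t => x t (+) u t])%:R.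
Proof.
rewrite /flip pauli_tensorE mul1r; case: eqVneq => [->|/basis_neqP [t]].
  by apply: big1 => t _; rewrite ffunE; case: (u t); case: (x t).
rewrite ffunE (bigD1 t) //=.
by case: (u t); case: (x t); case: (y t); rewrite /sigma //= mul0r.
Qed.

Lemma comm_flip_diag U x : GRing.comm U (flip x) ->
  U [ffun=> false] [ffun=> false] = U x x.
Proof.
set o := [ffun=> false] => /(congr1 (fun A : op T => A o x)).
have ox : [ffun t => o t (+) x t] = x by apply/ffunP => t; rewrite !ffunE.
rewrite !opmE (bigD1 o) //= big1 => [|z zo]; last first.
  rewrite flipE; case: eqP => [xz|]; rewrite ?mulr0 //; case/eqP: zo.
  apply/ffunP => t; move/ffunP/(_ t): xz; rewrite !ffunE.
  by case: (x t); case: (z t).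
rewrite (bigD1 x) //= big1 => [|z zx]; last by rewrite flipE ox (negPf zx) mul0r.
by rewrite !flipE ox eqxx mulr1 mul1r !addr0.
Qed.

Lemma pauli_centralizer U : (forall t e, GRing.comm U (pauli_at t e)) ->
  exists c, U = c%:A.
Proof.
move=> comm; exists (U [ffun=> false] [ffun=> false]).
apply: opP => x y; rewrite opZE op1E; have [<-|/basis_neqP [t xyt]] := eqVneq x y.
  rewrite mulr1; apply/esym/comm_flip_diag; rewrite /flip pauli_tensor_prod.
  by apply: commrZ; apply: commr_prod => t _; apply: comm.
by rewrite mulr0; apply: comm_pauliZ_offdiag xyt.
Qed.

End PauliCentralizer.

(** * Multiplexed and controlled operators *)

Section Agreement.
Variables (T : finType) (pT : predType T).
Implicit Types (D : pT) (x y z : basis T).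

Definition agree_off D x y : bool := [forall t, (t \notin D) ==> (x t == y t)].

Lemma agree_offP D x y : reflect (forall t, t \notin D -> x t = y t) (agree_off D x y).
Proof.
apply: (iffP forallP) => [xy t tD|xy t]; last by apply/implyP => /xy ->.
by have := xy t; rewrite tD => /eqP.
Qed.

Lemma agree_offxx D x : agree_off D x x. Proof. exact/agree_offP. Qed.

Lemma agree_off_sym D x y : agree_off D x y = agree_off D y x.
Proof. by apply: eq_forallb => t; rewrite eq_sym. Qed.

Lemma agree_off_transl D x y z : agree_off D x y -> agree_off D x z = agree_off D y z.
Proof.
move=> /agree_offP xy; apply/agree_offP/agree_offP => xz t tD; first by rewrite -xy ?xz.
by rewrite xy ?xz.
Qed.

Definition indep_of (A : Type) D (m : basis T -> A) : Prop :=
  forall x y, agree_off D x y -> m x = m y.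

Lemma indep_of_coord (A : Type) D (f : bool -> A) c : c \notin D ->
  indep_of D (fun x => f (x c)).
Proof. by move=> cD x y /agree_offP ->. Qed.

End Agreement.

Lemma indep_of_sub (T : finType) (pT pT' : predType T) (D : pT) (D' : pT') (A : Type)
    (m : basis T -> A) : {subset D <= D'} -> indep_of D' m -> indep_of D m.
Proof.
move=> DD' im x y /agree_offP xy; apply: im; apply/agree_offP => t tD'.
by apply: xy; apply: contraNN tD' => /DD'.
Qed.

Section Multiplexing.
Variables (S T : finType) (g : S -> T).
Hypothesis g_inj : injective g.
Implicit Types (x y z : basis T) (u : basis S) (m : basis T -> op S).

Definition restr (x : basis T) : basis S := [ffun s => x (g s)].

Definition glue (u : basis S) (x : basis T) : basis T :=
  [ffun t => if [pick s | g s == t] is Some s then u s else x t].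

Lemma glue_in u x s : glue u x (g s) = u s.
Proof.
rewrite ffunE; case: pickP => [s' /eqP/g_inj -> //|/(_ s)].
by rewrite eqxx.
Qed.

Lemma glue_out u x t : t \notin codom g -> glue u x t = x t.
Proof. by rewrite ffunE; case: pickP => // s /eqP <-; rewrite codom_f. Qed.

Lemma restr_glue u x : restr (glue u x) = u.
Proof. by apply/ffunP => s; rewrite ffunE glue_in. Qed.

Lemma agree_off_glue u x : agree_off (codom g) x (glue u x).
Proof. by apply/agree_offP => t tg; rewrite glue_out. Qed.

Lemma glue_restr x z : agree_off (codom g) x z -> glue (restr z) x = z.
Proof.
move=> /agree_offP xz; apply/ffunP => t.
have [/codomP [s ->]|tg] := boolP (t \in codom g); first by rewrite glue_in ffunE.
by rewrite glue_out ?xz.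
Qed.

Lemma eq_restr_agree x y : (restr x == restr y) && agree_off (codom g) x y = (x == y).
Proof.
apply/andP/eqP => [[/eqP xy off]|->]; last by rewrite eqxx agree_offxx.
by rewrite -(glue_restr off) -xy glue_restr ?agree_offxx.
Qed.

Lemma sum_agree_off x (F : basis T -> algC) :
  \sum_z F z * (agree_off (codom g) x z)%:R = \sum_u F (glue u x).
Proof.
rewrite (bigID (agree_off (codom g) x)) /= [X in _ + X]big1 ?addr0; last first.
  by move=> z /negPf ->; rewrite mulr0.
rewrite (reindex_onto (glue^~ x) restr) /=; last by move=> z /glue_restr.
apply: eq_big => [u|u _]; last by rewrite agree_off_glue mulr1.
by rewrite agree_off_glue restr_glue eqxx.
Qed.

(* [mux m] applies [m x] to the qubits [g s], the remaining qubits being in state [x]. *)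
Definition mux m : op T :=
  fun x y => m x (restr x) (restr y) * (agree_off (codom g) x y)%:R.

Lemma muxE m x y : mux m x y = m x (restr x) (restr y) * (agree_off (codom g) x y)%:R.
Proof. by []. Qed.

Lemma embedE G : embed g G = mux (fun=> G). Proof. by []. Qed.

Lemma eq_mux m m' : m =1 m' -> mux m = mux m'.
Proof. by move=> mm'; congr mux; apply/funext. Qed.

Lemma muxM m m' : indep_of (codom g) m' -> mux m * mux m' = mux (fun x => m x * m' x).
Proof.
move=> im'; apply: opP => x y; rewrite opmE muxE opmE mulr_suml.
under eq_bigr do rewrite !muxE mulrAC.
rewrite sum_agree_off; apply: eq_bigr => u _.
have xu := agree_off_glue u x.
by rewrite restr_glue -(im' _ _ xu) -(agree_off_transl _ xu) mulrA.
Qed.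

Lemma mux_adj m : indep_of (codom g) m -> adj (mux m) = mux (fun x => adj (m x)).
Proof.
move=> im; apply: opP => x y; rewrite /adj !muxE rmorphM /= conjC_nat agree_off_sym.
by case: (boolP (agree_off _ x y)) => [/im ->|_] //; rewrite !mulr0.
Qed.

Lemma muxD m m' : mux (fun x => m x + m' x) = mux m + mux m'.
Proof. by apply: opP => x y; rewrite opDE !muxE opDE mulrDl. Qed.

Lemma muxN m : mux (fun x => - m x) = - mux m.
Proof. by apply: opP => x y; rewrite opNE !muxE opNE mulNr. Qed.

Lemma muxZ a m : mux (fun x => a *: m x) = a *: mux m.
Proof. by apply: opP => x y; rewrite opZE !muxE opZE mulrA. Qed.

Lemma mux1 : mux (fun=> 1) = 1.
Proof. by apply: opP => x y; rewrite muxE !op1E -natrM mulnb eq_restr_agree. Qed.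

Lemma mux_pauliZ t : t \notin codom g ->
  pauli_at t letterZ = mux (fun x => ((-1) ^+ x t)%:A).
Proof.
move=> tg; apply: opP => x y; rewrite pauli_atZE muxE opZE op1E -mulrA.
by rewrite -natrM mulnb eq_restr_agree.
Qed.

Lemma embedM A B : embed g (A * B) = embed g A * embed g B.
Proof. by rewrite !embedE muxM. Qed.

Lemma embedD A B : embed g (A + B) = embed g A + embed g B.
Proof. by rewrite !embedE muxD. Qed.

Lemma embedZ a A : embed g (a *: A) = a *: embed g A.
Proof. by rewrite !embedE muxZ. Qed.

Lemma embed1 : embed g 1 = 1.
Proof. by rewrite embedE mux1. Qed.

Lemma embed_rot N : embed g (rot N) = rot (embed g N).
Proof. by rewrite /rot embedZ embedD embed1. Qed.

Lemma prod_codom (F : T -> algC) : \prod_(t in codom g) F t = \prod_s F (g s).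
Proof.
rewrite (reindex_omap g (fun t => [pick s | g s == t])) => [|t /codomP [s ->]].
  apply: eq_bigl => s; rewrite codom_f /=.
  by case: pickP => [s' /eqP/g_inj -> |/(_ s)]; rewrite eqxx.
by case: pickP => [s' /eqP/g_inj -> |/(_ s)] //; rewrite eqxx.
Qed.

Lemma pauli_tensor_embed c p : (forall t, t \notin codom g -> p t = ord0) ->
  pauli_tensor c p = embed g (pauli_tensor c (fun s => p (g s))).
Proof.
move=> p0; apply: opP => x y; rewrite embedE muxE !pauli_tensorE -mulrA; congr (_ * _).
rewrite (bigID (mem (codom g))) /= prod_codom; congr (_ * _).
  by apply: eq_bigr => s _; rewrite !ffunE.
case: (boolP (agree_off _ x y)) => [/agree_offP xy|].
  by rewrite big1 // => t tg; rewrite p0 // xy // /sigma eqxx.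
rewrite negb_forall => /existsP [t]; rewrite negb_imply => /andP [tg xyt].
by rewrite (bigD1 t) //= p0 // sigma_diag ?mul0r.
Qed.

Lemma embed_pauli_at s e : embed g (pauli_at s e) = pauli_at (g s) e.
Proof.
rewrite [RHS]pauli_tensor_embed => [|t tg]; last first.
  by rewrite /site_letter; case: eqP tg => // ->; rewrite codom_f.
by congr embed; apply: eq_pauli_tensor => s'; rewrite /site_letter (inj_eq g_inj).
Qed.

End Multiplexing.

Lemma const_ord1_inj (T : Type) (t : T) : injective (fun _ : 'I_1 => t).
Proof. by move=> i j _; rewrite !ord1. Qed.

Section DisjointSupports.
Variables (S S' T : finType) (g : S -> T) (g' : S' -> T).
Hypotheses (g_inj : injective g) (g'_inj : injective g').
Hypothesis disj : forall s s', g s != g' s'.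

Lemma mux_muxE (m : basis T -> op S) (m' : basis T -> op S') x y :
  indep_of (codom g) m' ->
  (mux g m * mux g' m') x y = m x (restr g x) (restr g y) *
    m' x (restr g' x) (restr g' y) *
    (agree_off [predU codom g & codom g'] x y)%:R.
Proof.
move=> im'; have [z z_in z_out] : exists2 z : basis T,
    forall s, z (g s) = y (g s) & forall t, t \notin codom g -> z t = x t.
  exists (glue g (restr g y) x) => [s|t]; last exact: glue_out.
  by rewrite glue_in // ffunE.
have xz : agree_off (codom g) x z by apply/agree_offP => t /z_out.
have notin_g s : g' s \notin codom g.
  by apply/codomP => -[s' /eqP]; rewrite eq_sym (negPf (disj _ _)).
rewrite opmE (bigD1 z) //= big1 ?addr0 => [|z' z'z].
  rewrite !muxE xz mulr1 -(im' x z) //.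
  have -> : restr g z = restr g y by apply/ffunP => s; rewrite !ffunE z_in.
  have -> : restr g' z = restr g' x by apply/ffunP => s; rewrite !ffunE z_out.
  rewrite mulrA; congr (_ * _%:R); congr nat_of_bool.
  apply/agree_offP/agree_offP => xy t.
    by rewrite inE negb_or => /andP [tg /xy]; rewrite z_out.
  have [/codomP [s ->] _|tg tg'] := boolP (t \in codom g); first exact: z_in.
  by rewrite z_out // xy // inE negb_or tg.
rewrite !muxE; case: agree_offP => [xz'|_]; last by rewrite mulr0 mul0r.
case: agree_offP => [z'y|_]; last by rewrite !mulr0.
case/eqP: z'z; apply/ffunP => t; have [/codomP [s ->]|tg] := boolP (t \in codom g).
  rewrite z_in z'y //; apply/codomP => -[s' /eqP]; exact/negP.
by rewrite z_out // xz'.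
Qed.

End DisjointSupports.

Lemma mux_comm (S S' T : finType) (g : S -> T) (g' : S' -> T)
    (m : basis T -> op S) (m' : basis T -> op S') :
  injective g -> injective g' -> (forall s s', g s != g' s') ->
  indep_of (codom g') m -> indep_of (codom g) m' ->
  GRing.comm (mux g m) (mux g' m').
Proof.
move=> gi gi' disj im im'; apply: opP => x y.
rewrite !mux_muxE // => [|s s']; last by rewrite eq_sym.
congr (_ * _%:R); first exact: mulrC.
by congr nat_of_bool; apply: eq_forallb => t; rewrite !inE orbC.
Qed.

Lemma embed_pauli_at_comm (S T : finType) (g : S -> T) A t e :
  injective g -> t \notin codom g -> GRing.comm (embed g A) (pauli_at t e).
Proof.
move=> gi tg; have ti := @const_ord1_inj _ t.
rewrite -(embed_pauli_at ti ord0) !embedE; apply: mux_comm => // s _.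
by apply: contraNneq tg => <-; apply: codom_f.
Qed.

Section ControlledGates.
Variables (S T : finType) (g : S -> T) (c : T).
Hypotheses (g_inj : injective g) (cg : c \notin codom g).
Implicit Types (A B : op S) (m : basis T -> op S).

Lemma ctrlE A : ctrl c g A = mux g (fun x => if x c then A else 1).
Proof.
apply: opP => x y; rewrite /ctrl embedE !muxE.
have [xy|xy] := boolP (agree_off (codom g) x y); last first.
  rewrite !mulr0; case: ifP => // _; case: ifP => // _.
  by rewrite -(eq_restr_agree g_inj) (negPf xy) andbF.
have := elimT (agree_offP _ x y) xy c cg => <-; case: (x c) => //=.
by rewrite op1E -(eq_restr_agree g_inj) xy andbT mulr1.
Qed.

Lemma indep_of_ctrl A : indep_of (codom g) (fun x => if x c then A else 1).
Proof. exact: (indep_of_coord (fun b : bool => if b then A else 1)). Qed.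

Lemma ctrlM A B : ctrl c g (A * B) = ctrl c g A * ctrl c g B.
Proof.
rewrite !ctrlE muxM //; last exact: indep_of_ctrl.
by apply: eq_mux => x; case: ifP; rewrite ?mulr1.
Qed.

Lemma ctrl_adj A : adj (ctrl c g A) = ctrl c g (adj A).
Proof.
rewrite !ctrlE mux_adj //; last exact: indep_of_ctrl.
by apply: eq_mux => x; case: ifP; rewrite ?adj1.
Qed.

Lemma ctrl1 : ctrl c g 1 = 1.
Proof. by rewrite ctrlE -(mux1 g_inj); apply: eq_mux => x; rewrite if_same. Qed.

Lemma ctrl_unitary A : is_unitary A -> is_unitary (ctrl c g A).
Proof.
by move=> uA; split; rewrite mulopE ctrl_adj -ctrlM ?unitary_mulrV ?unitary_mulVr ?ctrl1.
Qed.

Lemma eigen_ctrl_embed A : eigen_ctrl (pauli_at c letterZ) (embed g A) = ctrl c g A.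
Proof.
rewrite ctrlE /eigen_ctrl embedE (mux_pauliZ g_inj cg) -(mux1 g_inj) -muxN.
rewrite -!muxD -!muxZ muxM // -muxD; apply: eq_mux => x.
case: (x c); rewrite ?expr1 ?expr0 ?scaleN1r ?scale1r.
  by rewrite subrr scaler0 add0r opprK half_double mul1r.
by rewrite subrr scaler0 mul0r addr0 half_double.
Qed.

Lemma eigen_ctrlN_embed A :
  eigen_ctrl (-1 *: pauli_at c letterZ) (embed g A) =
  mux g (fun x => if x c then 1 else A).
Proof.
rewrite /eigen_ctrl embedE (mux_pauliZ g_inj cg) -(mux1 g_inj) -muxZ -muxN.
rewrite -!muxD -!muxZ muxM // -muxD; apply: eq_mux => x.
case: (x c); rewrite ?expr1 ?expr0 !scaleN1r ?scale1r ?opprK.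
  by rewrite subrr scaler0 mul0r addr0 half_double.
by rewrite subrr scaler0 add0r half_double mul1r.
Qed.

Lemma conj_by_ctrl A m : indep_of (codom g) m ->
  conj_by (ctrl c g A) (mux g m) = mux g (fun x => if x c then conj_by A (m x) else m x).
Proof.
move=> im; rewrite /conj_by ctrl_adj !ctrlE !muxM //; last exact: indep_of_ctrl.
by apply: eq_mux => x; case: (x c); rewrite // mul1r mulr1.
Qed.

Lemma comm_ctrl A E : GRing.comm (pauli_at c letterZ) E -> GRing.comm (embed g A) E ->
  GRing.comm (ctrl c g A) E.
Proof.
rewrite -qcomm1P -eigen_ctrl_embed => ZE AE.
by rewrite /GRing.comm (eigen_ctrl_qcomm ZE AE) scale1r.
Qed.

Lemma conj_by_ctrl_anti A E : is_unitary A ->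
  qcomm (-1) (pauli_at c letterZ) E -> GRing.comm (embed g A) E ->
  conj_by (ctrl c g A) E = E * mux g (fun x => if x c then adj A else A).
Proof.
move=> uA ZE AE; rewrite /conj_by ctrl_adj -eigen_ctrl_embed (eigen_ctrl_qcomm ZE AE).
rewrite eigen_ctrlN_embed ctrlE -mulrA muxM //; last exact: indep_of_ctrl.
by congr (_ * _); apply: eq_mux => x; case: (x c); rewrite ?mul1r ?mulr1.
Qed.

Lemma conj_by_ctrl_pauli_at A k q e : is_unitary A -> q \notin codom g ->
  let E := k *: pauli_at q e in
  conj_by (ctrl c g A) E = E \/
  c = q /\ conj_by (ctrl c g A) E = E * mux g (fun x => if x c then adj A else A).
Proof.
move=> uA qg E; have AE : GRing.comm (embed g A) E.
  by apply: commrZ; apply: embed_pauli_at_comm.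
have ZE : qcomm ((-1) ^+ ((c == q) && letter_anti letterZ e)) (pauli_at c letterZ) E.
  by apply: qcommZr; apply: pauli_at_qcomm.
have [/andP [/eqP cq anti]|/negPf comm] := boolP ((c == q) && letter_anti letterZ e).
  by right; split=> //; apply: conj_by_ctrl_anti; rewrite // cq eqxx anti in ZE *.
left; apply: conj_by_comm; first exact: ctrl_unitary.
by apply: comm_ctrl => //; rewrite comm qcomm1P in ZE.
Qed.

End ControlledGates.

Lemma comm_ctrl_mux (S S' T : finType) (g : S -> T) (g' : S' -> T) c A
    (m : basis T -> op S) (D : {set T}) :
  injective g -> injective g' -> {subset codom g <= D} -> {subset codom g' <= D} ->
  (forall s s', g s != g' s') -> c \notin D -> indep_of D m ->
  GRing.comm (ctrl c g' A) (mux g m).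
Proof.
move=> gi gi' gD gD' disj cD im; have cg : c \notin codom g by apply: contraNN cD => /gD.
have im_g := indep_of_sub gD im.
apply: comm_ctrl => //; first by apply: contraNN cD => /gD'.
  rewrite (mux_pauliZ gi cg) /GRing.comm !muxM //; last first.
    by move=> x y /agree_offP ->.
  by apply: eq_mux => x; rewrite mulr_algl mulr_algr.
apply/commr_sym; rewrite embedE; apply: mux_comm => //; exact: indep_of_sub gD' im.
Qed.

(** * Circuits of rotations *)

Section PauliWeight.
Variable T : finType.
Implicit Types (p q : T -> 'I_4) (P Q : op T).

Definition weight p : nat := #|[set t | p t != ord0]|.

Definition light_pauli (w : nat) P : Prop := exists c p,
  [/\ c ^+ 4 = 1, P = pauli_tensor c p & (weight p <= w)%N].

Lemma weight_le (A : {set T}) p : (forall t, t \notin A -> p t = ord0) ->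
  (weight p <= #|A|)%N.
Proof.
move=> p0; apply/subset_leq_card/subsetP => t; rewrite inE.
by apply: contraR => /p0 ->.
Qed.

Lemma light_is_pauli w P : light_pauli w P -> is_pauli P.
Proof. by move=> [c [p [c4 -> _]]]; exists c, p. Qed.

Lemma pauli_light P : is_pauli P -> light_pauli #|T| P.
Proof. by move=> [c [p [c4 ->]]]; exists c, p; split=> //; apply: max_card. Qed.

Lemma light_pauli_le w w' P : (w <= w')%N -> light_pauli w P -> light_pauli w' P.
Proof.
by move=> ww' [c [p [c4 Pcp pw]]]; exists c, p; split=> //; apply: leq_trans ww'.
Qed.

Lemma light_pauliZ k w P : k ^+ 4 = 1 -> light_pauli w P -> light_pauli w (k *: P).
Proof.
move=> k4 [c [p [c4 -> pw]]]; exists (k * c), p; rewrite pauli_tensorZ; split=> //.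
by rewrite exprMn k4 c4 mulr1.
Qed.

Lemma light_pauliM w w' P Q : light_pauli w P -> light_pauli w' Q ->
  light_pauli (w + w') (P * Q).
Proof.
move=> [c [p [c4 -> pw]]] [d [q [d4 -> qw]]]; rewrite pauli_tensorM.
do 2!eexists; split; [|reflexivity|].
  by rewrite !exprMn c4 d4 pauli_phase_root4 !mul1r.
apply: leq_trans (leq_add pw qw); apply: leq_trans (leq_card_setU _ _).
by apply: weight_le => t; rewrite !inE negb_or !negbK => /andP [/eqP -> /eqP ->].
Qed.

Lemma light_pauli_at a e : light_pauli 1 (pauli_at a e : op T).
Proof.
exists 1, (site_letter a e); split=> //; first exact: expr1n.
by rewrite -(cards1 a); apply: weight_le => t; rewrite inE /site_letter => /negPf ->.
Qed.

End PauliWeight.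

Lemma light_pauli_embed (S T : finType) (g : S -> T) w (P : op S) :
  injective g -> light_pauli w P -> light_pauli w (embed g P).
Proof.
move=> gi [c [p [c4 -> pw]]].
pose q t := if [pick s | g s == t] is Some s then p s else ord0.
have qg s : q (g s) = p s.
  by rewrite /q; case: pickP => [s' /eqP/gi ->|/(_ s)] //; rewrite eqxx.
have q0 t : t \notin codom g -> q t = ord0.
  by rewrite /q; case: pickP => // s /eqP <-; rewrite codom_f.
exists c, q; split=> //.
  by rewrite (pauli_tensor_embed gi) //; congr embed; apply: eq_pauli_tensor => s.
apply: leq_trans pw; rewrite {2}/weight -(card_imset _ gi); apply: weight_le => t tS.
have [/codomP [s ts]|/q0 //] := boolP (t \in codom g); rewrite ts qg; apply/eqP.
by apply: contraNT tS => ps; rewrite ts imset_f // inE.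
Qed.

Section RotationCircuits.
Variable T : finType.
Implicit Types (N P Q U V A : op T) (n m w : nat).

Definition local_axis N : Prop := light_pauli 2 N /\ N * N = -1.

Lemma rot_adj_pauli N : is_pauli N -> N * N = -1 -> adj (rot N) = rot (- N).
Proof. by move=> /pauli_unitary; apply: rot_adj. Qed.

Lemma rot_clifford N : is_pauli N -> N * N = -1 -> is_clifford (rot N).
Proof.
move=> pN NN; have aR := rot_adj_pauli pN NN; split.
  by split; rewrite aR mulopE ?rotNK // -{2}(opprK N) rotNK // mulrNN.
move=> P pP; rewrite !mulopE aR.
have [e [] -> NP] := pauli_sign_comm pN pP.
  by rewrite rot_conj_comm // -qcomm1P.
by rewrite rot_conj_anti //; apply: pauliM.
Qed.

Lemma scalar_clifford a : a * a^* = 1 -> is_clifford (a%:A : op T).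
Proof.
move=> aa; split; first by apply: unitaryZ => //; apply: unitary1.
move=> P pP; rewrite !mulopE adjZ adj1 scalerMl mul1r scalerMl scalerMr mulr1.
by rewrite scalerA aa scale1r.
Qed.

Lemma cliffordM U V : is_clifford U -> is_clifford V -> is_clifford (U * V).
Proof.
move=> [uU cU] [uV cV]; split; first exact: unitaryM.
by move=> P /cV /cU; rewrite !mulopE adjM !mulrA.
Qed.

Lemma pauli_clifford P : is_pauli P -> is_clifford P.
Proof.
move=> pP; split; first exact: pauli_unitary.
by move=> Q pQ; apply: pauliM; [apply: pauliM | apply: pauli_adj].
Qed.

Lemma local_axis_adj N : local_axis N -> adj (rot N) = rot (- N).
Proof. by case=> /light_is_pauli; apply: rot_adj_pauli. Qed.

Lemma local_axis_opp N : local_axis N -> local_axis (- N).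
Proof.
case=> lN NN; split; last by rewrite mulrNN.
rewrite -scaleN1r; apply: light_pauliZ lN; exact: root4_N1.
Qed.

Inductive rotcirc : nat -> op T -> Prop :=
| rotcirc_scalar n c : c * c^* = 1 -> rotcirc n c%:A
| rotcirc_rot n N U : local_axis N -> rotcirc n U -> rotcirc n.+1 (rot N * U).

Lemma rotcirc_le n m U : (n <= m)%N -> rotcirc n U -> rotcirc m U.
Proof.
move=> nm rU; elim: rU m nm => [{}n c cc m _|{}n N V lN _ IH [|m]] //.
  exact: rotcirc_scalar.
by move=> nm; apply: rotcirc_rot => //; apply: IH.
Qed.

Lemma rotcirc1 n : rotcirc n 1.
Proof. by rewrite -(scale1r 1); apply: rotcirc_scalar; rewrite rmorph1 mulr1. Qed.

Lemma rotcirc_local N : local_axis N -> rotcirc 1 (rot N).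
Proof.
by move=> lN; rewrite -[rot N]mulr1; apply: rotcirc_rot => //; apply: rotcirc1.
Qed.

Lemma rotcircZ n c U : c * c^* = 1 -> rotcirc n U -> rotcirc n (c *: U).
Proof.
move=> cc; elim=> [{}n d dd|{}n N V lN _ IH].
  by rewrite scalerA; apply: rotcirc_scalar; rewrite rmorphM mulrACA cc dd mulr1.
by rewrite -scalerMr; apply: rotcirc_rot.
Qed.

Lemma rotcircM n m U V : rotcirc n U -> rotcirc m V -> rotcirc (n + m) (U * V).
Proof.
elim=> [{}n c cc|{}n N U' lN _ IH] rV.
  by rewrite mulr_algl; apply: rotcirc_le (rotcircZ cc rV); apply: leq_addl.
by rewrite -mulrA addSn; apply: rotcirc_rot => //; apply: IH.
Qed.

Lemma rotcirc_prod n (I : finType) (F : I -> op T) :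
  (forall i, rotcirc n (F i)) -> rotcirc (#|I| * n) (\prod_i F i).
Proof.
move=> rF; rewrite [index_enum I]unlock -enumT cardE.
elim: (enum I) => [|i r IH]; first by rewrite big_nil; apply: rotcirc1.
by rewrite big_cons mulSn; apply: rotcircM.
Qed.

Lemma rotcirc_adj n U : rotcirc n U -> rotcirc n (adj U).
Proof.
elim=> [{}n c cc|{}n N V lN _ IH].
  by rewrite adjZ adj1; apply: rotcirc_scalar; rewrite conjCK mulrC.
rewrite adjM local_axis_adj // -addn1; apply: rotcircM => //.
exact: rotcirc_local (local_axis_opp lN).
Qed.

Lemma rotcirc_conj n m G U : rotcirc n G -> rotcirc m U ->
  rotcirc (n + m + n) (conj_by G U).
Proof. by move=> rG rU; apply: rotcircM (rotcirc_adj rG); apply: rotcircM. Qed.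

Lemma rotcirc_clifford n U : rotcirc n U -> is_clifford U.
Proof.
elim=> [{}n c cc|{}n N V [/light_is_pauli pN NN] _ IH]; first exact: scalar_clifford.
by apply: cliffordM => //; apply: rot_clifford.
Qed.

Lemma rotcirc_unitary n U : rotcirc n U -> is_unitary U.
Proof. by case/rotcirc_clifford. Qed.

Lemma rotcirc_light_pauli P : light_pauli 2 P -> rotcirc 2 P.
Proof.
move=> lP; have axis Q : local_axis Q -> rotcirc 2 Q.
  by move=> lQ; rewrite -(rot_sqr lQ.2); apply: (@rotcircM 1 1); apply: rotcirc_local.
have [e [] -> PP] := pauli_sqr (light_is_pauli lP); last first.
  by apply: axis; split=> //; rewrite PP scaleN1r.
have -> : P = - 'i *: ('i *: P) by rewrite scalerA mulNr sqr_i opprK scale1r.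
apply: rotcircZ; first by rewrite rmorphN mulrNN root4_conj ?root4_i.
apply: axis; split; first exact: light_pauliZ root4_i _.
by rewrite scalerMl scalerMr scalerA sqr_i PP scale1r scaleN1r.
Qed.

Lemma rotcirc_eigen_ctrl P Q : light_pauli 1 P -> light_pauli 1 Q ->
  P * P = 1 -> Q * Q = 1 -> GRing.comm P Q -> rotcirc 3 (eigen_ctrl P Q).
Proof.
move=> lP lQ PP QQ PQ; rewrite eigen_ctrl_rot //.
have axis k A : light_pauli 2 A -> k * k = -1 -> A * A = 1 -> local_axis (k *: A).
  move=> lA kk AA; split; first exact/light_pauliZ/lA/sqrN1_root4.
  by rewrite scalerMl scalerMr scalerA kk AA scaleN1r.
apply: rotcircZ; first exact/sqrN1_phase_norm/sqr_i.
apply: (@rotcircM 2 1); first apply: (@rotcircM 1 1); apply: rotcirc_local; apply: axis;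
  rewrite ?mulrNN ?sqr_i //.
- exact: light_pauli_le lP.
- exact: light_pauli_le lQ.
- exact: (light_pauliM lP lQ).
- by rewrite {1}PQ mulrA -(mulrA Q) PP mulr1 QQ.
Qed.

Lemma rotcirc_eigen_phase P c : light_pauli 2 P -> P * P = 1 -> c ^+ 4 = 1 ->
  rotcirc 2 (eigen_ctrl P c%:A).
Proof.
move=> lP PP /root4P [->|->|cc].
- by rewrite scale1r eigen_ctrl1; apply: rotcirc1.
- by rewrite scaleN1r eigen_ctrlN1; apply: rotcirc_light_pauli.
rewrite eigen_ctrl_phase //; apply: rotcircZ; first exact: sqrN1_phase_norm.
apply: (@rotcirc_le 1) => //; apply: rotcirc_local; split.
  by apply: light_pauliZ => //; apply: sqrN1_root4; rewrite mulrNN.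
by rewrite scalerMl scalerMr scalerA mulrNN cc PP scaleN1r.
Qed.

Lemma weight_reduction c (p : T -> 'I_4) : c ^+ 4 = 1 ->
  pauli_tensor c p * pauli_tensor c p = -1 -> (1 < weight p)%N ->
  exists R q, [/\ local_axis R, (weight q < weight p)%N &
    conj_by (rot R) (pauli_tensor c p) = pauli_tensor c q].
Proof.
move=> c4 NN /card_gt1P [a [b []]]; rewrite !inE => pa pb ab.
have [o] := common_anti_letter pa pa; rewrite andbb => ao.
pose q t := if t == a then o else if t == b then ord0 else p t.
have qE : pauli_tensor c q * pauli_tensor c q = -1.
  by rewrite pauli_tensor_sqr -(pauli_tensor_sqr c p).
have anti : qcomm (-1) (pauli_tensor c p) (pauli_tensor c q).
  have := pauli_tensor_qcomm c c p q; rewrite (@pauli_sign_single _ _ _ a) => [|t ta].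
    by rewrite /q eqxx ao.
  by rewrite /q (negPf ta); case: eqP; rewrite ?letter_antir0 ?letter_antiaa.
have lR : light_pauli 2 (-1 *: (pauli_tensor c q * pauli_tensor c p)).
  apply: light_pauliZ; first exact: root4_N1.
  rewrite pauli_tensorM; do 2!eexists; split; [|reflexivity|].
    by rewrite !exprMn c4 pauli_phase_root4 !mul1r.
  rewrite -[2%N](_ : #|[set a; b]| = 2%N); last by rewrite cards2 ab.
  apply: weight_le => t; rewrite !inE negb_or /q => /andP [/negPf -> /negPf ->].
  exact: letter_mulaa.
have N1 : -1 = (-1)%:A :> op T by rewrite scaleN1r.
rewrite N1 in NN qE.
have [RR RN] := rot_conj_swap (is_signN1 _) NN qE anti.
exists (-1 *: (pauli_tensor c q * pauli_tensor c p)), q; split; first by split.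
  apply/proper_card/properP; split; last first.
    by exists b; rewrite !inE // /q (eq_sym b) (negPf ab) !eqxx.
  apply/subsetP => t; rewrite !inE /q; case: (eqVneq t a) => [->|_] //.
  by case: (eqVneq t b) => [_|//]; rewrite eqxx.
by rewrite /conj_by local_axis_adj.
Qed.

Lemma rotcirc_rot_light w N : light_pauli w.+2 N -> N * N = -1 ->
  rotcirc w.*2.+1 (rot N).
Proof.
elim: w N => [|w IH] N lN NN; first exact: rotcirc_local.
have [c [p [c4 Nc pw]]] := lN; have [pw'|wp] := leqP (weight p) w.+2.
  have lN' : light_pauli w.+2 N by exists c, p.
  by apply: rotcirc_le (IH N lN' NN); rewrite ltnS leq_double.
have p_gt1 : (1 < weight p)%N by apply: leq_trans wp.
rewrite Nc in NN *; have [R [q [lR qp Rp]]] := weight_reduction c4 NN p_gt1.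
have uR := rotcirc_unitary (rotcirc_local lR).
rewrite -(conj_byK uR (rot _)) conj_by_rot // Rp doubleS -addn1.
have rRa := rotcirc_adj (rotcirc_local lR).
apply: (@rotcirc_conj 1 w.*2.+1) => //; apply: IH.
  by exists c, q; split=> //; rewrite -ltnS; apply: leq_trans pw.
by rewrite -Rp -conj_byMr // NN -scaleN1r conj_byZ conj_by_one.
Qed.

Lemma rotcirc_rot_pauli N : is_pauli N -> N * N = -1 -> rotcirc (#|T|.*2.+1) (rot N).
Proof.
move=> pN NN; apply: rotcirc_rot_light NN; apply: light_pauli_le (pauli_light pN).
by rewrite -addn2 leq_addr.
Qed.

End RotationCircuits.

Lemma rotcirc_embed (S T : finType) (g : S -> T) n (U : op S) :
  injective g -> rotcirc n U -> rotcirc n (embed g U).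
Proof.
move=> gi; elim=> [{}n c cc|{}n N V [lN NN] _ IH].
  by rewrite embedZ embed1 //; apply: rotcirc_scalar.
rewrite embedM // embed_rot //; apply: rotcirc_rot => //.
split; first exact: light_pauli_embed.
by rewrite -embedM // NN -scaleN1r embedZ embed1 // scaleN1r.
Qed.

Section SmallGates.
Variables (T : finType) (t0 : T).

Lemma small_rot (N : op T) : local_axis N -> small_clifford_gate (rot N).
Proof.
move=> [[c [p [c4 -> pw]]] NN].
have [A [A0 A2 pA]] : exists A : {set T},
    [/\ (0 < #|A|)%N, (#|A| <= 2)%N & forall t, t \notin A -> p t = ord0].
  have [p0|p0] := posnP (weight p); last first.
    by exists [set t | p t != ord0]; split=> // t; rewrite inE negbK => /eqP.
  exists [set t0]; rewrite cards1; split=> // t _; apply/eqP; move/eqP: p0.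
  by rewrite cards_eq0 => /eqP/setP/(_ t); rewrite !inE => /negbFE.
have g_inj := @enum_val_inj _ (mem A).
have Ag t : t \notin codom (@enum_val _ (mem A)) -> p t = ord0.
  move=> tA; apply: pA; apply: contraNN tA => tA.
  by rewrite -(enum_rankK_in tA tA) codom_f.
exists #|A|, (@enum_val _ (mem A)), (rot (pauli_tensor c (fun s => p (enum_val s)))).
have Np := pauli_tensor_embed g_inj c Ag; split=> //; first by lia.
  apply: rot_clifford; first by eexists; eexists; split; first exact: c4.
  rewrite pauli_tensor_sqr; rewrite pauli_tensor_sqr -scaleN1r in NN.
  by rewrite (scaler1_inj NN) scaleN1r.
by rewrite embed_rot // -Np.
Qed.

Lemma small_scalar c : c * c^* = 1 -> small_clifford_gate (c%:A : op T).
Proof.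
move=> cc; exists 1%N, (fun=> t0), c%:A; split=> //.
- by left.
- exact: const_ord1_inj.
- exact: scalar_clifford.
- by rewrite embedZ embed1 //; apply: const_ord1_inj.
Qed.

Lemma all_prop_rcons (A : Type) (Q : A -> Prop) s a :
  all_prop Q s -> Q a -> all_prop Q (rcons s a).
Proof. by elim: s => [|b s IH] /= => [_|[Qb /IH Qs]] Qa; split=> //; apply: Qs. Qed.

Lemma rotcirc_small_gates n (U : op T) : rotcirc n U -> exists gs,
  [/\ all_prop (@small_clifford_gate T) gs, (size gs <= n.+1)%N & U = circ gs].
Proof.
elim=> [{}n c cc|{}n N V lN _ [gs [small_gs ngs ->]]].
  exists [:: c%:A]; split=> //=; last by rewrite circ_cons circ_nil mul1r.
  by split=> //; apply: small_scalar.
exists (rcons gs (rot N)); rewrite size_rcons circ_rcons; split=> //.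
by apply: all_prop_rcons => //; apply: small_rot.
Qed.

End SmallGates.

(** * Clifford synthesis *)

Definition clifford_cost (n : nat) : nat := n * (4 * n.*2.+1).

Lemma clifford_cost_le n m : (n <= m)%N -> (clifford_cost n <= clifford_cost m)%N.
Proof. by move=> nm; apply: leq_mul => //; rewrite leq_mul2l ltnS leq_double. Qed.

Section CliffordSynthesis.
Variable T : finType.
Implicit Types (A B G P Q R U : op T) (C : op T -> Prop) (F : {set T}) (a t : T).

Definition reflection P : Prop := is_pauli P /\ P * P = 1.

Lemma reflection_at a e : reflection (pauli_at a e).
Proof. by split; [apply: pauli_at_pauli | apply: pauli_at_sqr]. Qed.

Definition centralizes C U : Prop := forall A, C A -> GRing.comm U A.

Definition carries C n A B : Prop :=
  exists2 G, rotcirc n G /\ centralizes C G & conj_by G A = B.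

Lemma carries_trans C n m A B B' :
  carries C n A B -> carries C m B B' -> carries C (m + n) A B'.
Proof.
move=> [G [rG cG] <-] [H [rH cH] <-]; exists (H * G); last by rewrite conj_byMl.
split=> [|X CX]; first exact: rotcircM.
by apply/commr_sym/commrM; apply/commr_sym; [apply: cH | apply: cG].
Qed.

Lemma carries_le C n m A B : (n <= m)%N -> carries C n A B -> carries C m A B.
Proof. by move=> nm [G [rG cG] GA]; exists G => //; split=> //; apply: rotcirc_le rG. Qed.

(* The rotation about [B * A] exchanges anticommuting reflections [A] and [B]. *)
Lemma carries_swap C A B : reflection A -> reflection B -> qcomm (-1) A B ->
  (forall X, C X -> GRing.comm X (B * A)) -> carries C (#|T|.*2.+1) A B.
Proof.
move=> [pA AA] [pB BB] anti cBA; have one : 1 = 1%:A :> op T by rewrite scale1r.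
rewrite one in AA BB.
have [NN NA] := rot_conj_swap (is_sign1 _) AA BB anti.
have pN : is_pauli (1 *: (B * A)) by rewrite scale1r; apply: pauliM.
exists (rot (1 *: (B * A))); last by rewrite /conj_by rot_adj_pauli.
split=> [|X CX]; first exact: rotcirc_rot_pauli.
by apply: comm_rot; rewrite scale1r; apply/commr_sym/cBA.
Qed.

Lemma carries_through C A B R : reflection A -> reflection B -> reflection R ->
  qcomm (-1) A R -> qcomm (-1) R B ->
  (forall X, C X -> GRing.comm X (R * A)) -> (forall X, C X -> GRing.comm X (B * R)) ->
  carries C (2 * #|T|.*2.+1) A B.
Proof.
move=> rA rB rR AR RB cRA cBR; rewrite mul2n -addnn.
by apply: (@carries_trans _ _ _ _ R); apply: carries_swap.
Qed.

Variant site_off F : op T -> Prop :=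
  SiteOff t e of t \notin F : site_off F (pauli_at t e).

Variant site_off_or_X F a : op T -> Prop :=
  | OrSiteOff X of site_off F X : site_off_or_X F a X
  | OrPauliX : site_off_or_X F a (pauli_at a letterX).

Lemma site_off_pauli_at F X a e : site_off F X -> a \in F -> GRing.comm X (pauli_at a e).
Proof. by case=> t f tF aF; apply: pauli_at_comm; apply: contraNneq tF => ->. Qed.

Lemma reflection_conj U P : is_clifford U -> reflection P -> reflection (conj_by U P).
Proof.
move=> [uU cU] [pP PP]; split; first exact: cU.
by rewrite -conj_byMr // PP conj_by_one.
Qed.

Lemma centralizes_conj C U A : is_unitary U -> centralizes C U ->
  (forall X, C X -> GRing.comm X A) -> forall X, C X -> GRing.comm X (conj_by U A).
Proof.
move=> uU cU cA X CX; rewrite -(conj_by_comm uU (cU X CX)) -qcomm1P.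
by apply: qcomm_conj_by => //; rewrite qcomm1P; apply: cA.
Qed.

(* If [P] is nontrivial at [a], a single-site Pauli there anticommutes with both
   [P] and [pauli_at a e]; otherwise such a Pauli is combined with the letter of [Q]
   at some site where [P] and [Q] anticommute. *)
Lemma common_anticommuting_reflection P Q F a e : reflection P -> is_pauli Q ->
  qcomm (-1) P Q -> a \in F -> e != ord0 -> (forall X, site_off F X -> GRing.comm X P) ->
  exists R, [/\ reflection R, qcomm (-1) P R, qcomm (-1) R (pauli_at a e) &
    forall X, site_off F X -> GRing.comm X R].
Proof.
move=> [pP PP] pQ PQ aF e0 offP.
have [c [p [c4 Pcp]]] := pP; have [d [q [d4 Qdq]]] := pQ; subst P Q.
have [pa|pa] := eqVneq (p a) ord0; last first.
  have [o /andP [po eo]] := common_anti_letter pa e0; exists (pauli_at a o).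
  split; first exact: reflection_at.
  - by have := pauli_tensor_at_qcomm c p a o; rewrite po.
  - exact: qcomm_sym (is_signN1 _) (pauli_at_anti a eo).
  - by move=> X offX; apply: site_off_pauli_at offX aF.
have [b pqb] := pauli_anti_letter pP pQ PQ.
have ba : a != b by apply: contraTneq pqb => <-; rewrite pa.
have bF : b \in F.
  apply/negPn/negP => bF; have comm := commr_sym (offP _ (SiteOff (q b) bF)).
  apply: (unitary_comm_anti (pauli_unitary pP) (pauli_unitary (pauli_at_pauli _ _)) comm).
  by have := pauli_tensor_at_qcomm c p b (q b); rewrite pqb.
have [o] := common_anti_letter e0 e0; rewrite andbb => eo.
have comm : GRing.comm (pauli_at a o) (pauli_at b (q b)) by apply: pauli_at_comm.
exists (pauli_at a o * pauli_at b (q b)); split.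
- split; first by apply: pauliM; apply: pauli_at_pauli.
  by rewrite {1}comm mulrA -[X in X * _]mulrA pauli_at_sqr mulr1 pauli_at_sqr.
- rewrite -[-1]mul1r; apply: qcommMr.
    by have := pauli_tensor_at_qcomm c p a o; rewrite pa.
  by have := pauli_tensor_at_qcomm c p b (q b); rewrite pqb.
- rewrite -[-1]mulr1; apply: qcommMl.
    exact: qcomm_sym (is_signN1 _) (pauli_at_anti a eo).
  by rewrite qcomm1P; apply: pauli_at_comm; rewrite eq_sym.
- by move=> X offX; apply: commrM; apply: site_off_pauli_at offX _.
Qed.

Lemma pauliXZ_anti a : qcomm (-1) (pauli_at a letterX) (pauli_at a letterZ).
Proof. exact: pauli_at_anti. Qed.

Lemma carries_to_X U F a : is_clifford U -> a \in F -> centralizes (site_off F) U ->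
  carries (site_off F) (2 * #|T|.*2.+1)
    (conj_by U (pauli_at a letterX)) (pauli_at a letterX).
Proof.
move=> cU aF offU; have rX := reflection_at a letterX.
have rP := reflection_conj cU rX.
have [pQ _] := reflection_conj cU (reflection_at a letterZ).
have PQ := qcomm_conj_by cU.1 (pauliXZ_anti a).
have offP X : site_off F X -> GRing.comm X (conj_by U (pauli_at a letterX)).
  by apply: (centralizes_conj cU.1 offU) => A offA; apply: site_off_pauli_at offA aF.
have [//|R [rR PR RX offR]] :=
  common_anticommuting_reflection (e := letterX) rP pQ PQ aF _ offP.
apply: (carries_through rP rX rR PR RX) => X offX.
  by apply: commrM; [apply: offR | apply: offP].
by apply: commrM; [apply: site_off_pauli_at offX aF | apply: offR].
Qed.

Lemma comm_site_off_or_X F a A B :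
  (forall X, site_off F X -> GRing.comm X A) ->
  (forall X, site_off F X -> GRing.comm X B) ->
  qcomm (-1) (pauli_at a letterX) A -> qcomm (-1) (pauli_at a letterX) B ->
  forall X, site_off_or_X F a X -> GRing.comm X (A * B).
Proof.
move=> offA offB XA XB X [{}X offX|]; last exact: qcommN1_comm.
by apply: commrM; [apply: offA | apply: offB].
Qed.

(* Both the source and the target anticommute with [X_a], and so does [Y_a]: the
   rotations exchanging them therefore commute with [X_a]. *)
Lemma carries_to_Z U F a : is_clifford U -> a \in F ->
  centralizes (site_off_or_X F a) U ->
  carries (site_off_or_X F a) (2 * #|T|.*2.+1)
    (conj_by U (pauli_at a letterZ)) (pauli_at a letterZ).
Proof.
move=> cU aF offU; have rQ := reflection_conj cU (reflection_at a letterZ).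
have offat e X : site_off F X -> GRing.comm X (pauli_at a e).
  by move=> offX; apply: site_off_pauli_at offX aF.
have offQ X : site_off F X -> GRing.comm X (conj_by U (pauli_at a letterZ)).
  move: X; apply: (centralizes_conj cU.1 _ (offat _)) => X offX.
  exact/offU/OrSiteOff.
have XY : qcomm (-1) (pauli_at a letterX) (pauli_at a letterY).
  exact: pauli_at_anti.
have XQ : qcomm (-1) (pauli_at a letterX) (conj_by U (pauli_at a letterZ)).
  rewrite -(conj_by_comm cU.1 (offU _ (OrPauliX F a))).
  exact: (qcomm_conj_by cU.1 (pauliXZ_anti a)).
have [[c [q [c4 Qcq]]] _] := rQ; move: rQ XQ offQ; rewrite Qcq => rQ XQ offQ.
have := pauli_anti_at rQ.1 (qcomm_sym (is_signN1 _) XQ).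
move: (pauli_tensor_at_qcomm c q a letterY) (pauli_tensor_at_qcomm c q a letterZ).
case: (letterP (q a)) => //= QY QZ _.
  apply: (@carries_le _ #|T|.*2.+1); first exact: leq_pmull.
  apply: (carries_swap rQ (reflection_at a letterZ) QZ).
  exact: comm_site_off_or_X (offat _) offQ (pauliXZ_anti a) XQ.
apply: (carries_through rQ (reflection_at a letterZ) (reflection_at a letterY) QY _).
- exact: pauli_at_anti.
- exact: comm_site_off_or_X (offat _) offQ XY XQ.
- exact: comm_site_off_or_X (offat _) (offat _) (pauliXZ_anti a) XY.
Qed.

Lemma clifford_fix_site U F a : is_clifford U -> a \in F -> centralizes (site_off F) U ->
  exists2 G, rotcirc (4 * #|T|.*2.+1) G & centralizes (site_off (F :\ a)) (G * U).
Proof.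
move=> cU aF offU; have [G [rG offG] GX] := carries_to_X cU aF offU.
have cGU : is_clifford (G * U) by apply: cliffordM => //; apply: rotcirc_clifford rG.
rewrite -conj_byMl in GX.
have comm_of_fixed A (X : op T) : conj_by A X = X -> is_clifford A -> GRing.comm A X.
  by move=> AX [uA _]; rewrite -qcomm1P; apply: qcomm_conj_byP; rewrite ?scale1r.
have offGU : centralizes (site_off_or_X F a) (G * U).
  move=> X [{}X offX|]; last exact: comm_of_fixed GX cGU.
  by apply/commr_sym/commrM; apply/commr_sym; [apply: offG | apply: offU].
have [H [rH offH] HZ] := carries_to_Z cGU aF offGU.
have cHGU : is_clifford (H * (G * U)).
  by apply: cliffordM => //; apply: rotcirc_clifford rH.
rewrite -conj_byMl in HZ.
have offHGU : centralizes (site_off_or_X F a) (H * (G * U)).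
  by move=> X offX; apply/commr_sym/commrM; apply/commr_sym; [apply: offH | apply: offGU].
exists (H * G); first by rewrite (mulnDl 2 2); apply: rotcircM.
rewrite -mulrA => X [t e]; rewrite !inE negb_and negbK => /orP [/eqP ->|tF]; last first.
  exact/offHGU/OrSiteOff.
have HX := offHGU _ (OrPauliX F a); have {}HZ := comm_of_fixed _ _ HZ cHGU.
case: (letterP e) => //; first by rewrite pauli_at0; apply: commr1.
by rewrite pauli_atY; apply: commrZ; apply: commrM.
Qed.

Lemma centralized_clifford_rotcirc n U F : (#|F| <= n)%N -> is_clifford U ->
  centralizes (site_off F) U -> rotcirc (n * (4 * #|T|.*2.+1)) U.
Proof.
elim: n U F => [|n IH] U F.
  rewrite leqn0 cards_eq0 => /eqP -> cU offU.
  have [t e|c Uc] := @pauli_centralizer T U.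
    by apply: offU; constructor; rewrite inE.
  by rewrite Uc in cU *; apply: rotcirc_scalar; apply: (unitary_scalar_norm cU.1).
move=> Fn cU offU; have [F0|[a aF]] := set_0Vmem F.
  by apply: rotcirc_le (IH U F _ cU offU); rewrite ?F0 ?cards0 // leq_mul2r leqnSn orbT.
have [G rG offGU] := clifford_fix_site cU aF offU.
have uG := rotcirc_unitary rG; rewrite -(unitary_mulKr U uG) mulSn.
apply: rotcircM; first exact: rotcirc_adj.
apply: IH offGU; first by rewrite (cardsD1 a) aF in Fn.
exact: cliffordM (rotcirc_clifford rG) cU.
Qed.

Theorem clifford_rotcirc U : is_clifford U -> rotcirc (clifford_cost #|T|) U.
Proof.
move=> cU; apply: (@centralized_clifford_rotcirc _ U [set: T]); rewrite ?cardsT //.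
by move=> X [t e]; rewrite inE.
Qed.

End CliffordSynthesis.

(** * Errors in a block of data qubits *)

Section ControlledPaulis.
Variables (S T : finType) (g : S -> T).
Hypothesis g_inj : injective g.
Implicit Types (b c : T) (J : seq T) (P : op S).

Lemma rotcirc_ctrl_pauli_at c s e : c \notin codom g ->
  rotcirc 3 (ctrl c g (pauli_at s e)).
Proof.
move=> cg; rewrite -eigen_ctrl_embed // embed_pauli_at //.
apply: rotcirc_eigen_ctrl; rewrite ?pauli_at_sqr //; try exact: light_pauli_at.
by apply: pauli_at_comm; apply: contraNneq cg => ->; apply: codom_f.
Qed.

Lemma rotcirc_ctrl_scalar c a : c \notin codom g -> a ^+ 4 = 1 ->
  rotcirc 2 (ctrl c g a%:A).
Proof.
move=> cg a4; rewrite -eigen_ctrl_embed // embedZ embed1 //.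
apply: rotcirc_eigen_phase => //; last exact: pauli_at_sqr.
exact: light_pauli_le (light_pauli_at _ _).
Qed.

Lemma rotcirc_ctrl_pauli c P : c \notin codom g -> is_pauli P ->
  rotcirc (3 * #|S| + 2) (ctrl c g P).
Proof.
move=> cg [a [p [a4 ->]]]; rewrite pauli_tensor_prod -mulr_algl ctrlM //.
rewrite (big_morph _ (ctrlM g_inj cg) (ctrl1 g_inj cg)) addnC mulnC.
apply: rotcircM; first exact: rotcirc_ctrl_scalar.
by apply: rotcirc_prod => s; apply: rotcirc_ctrl_pauli_at.
Qed.

Definition parity_sign J (x : basis T) : algC := \prod_(c <- J) (-1) ^+ x c.

Lemma indep_of_parity_sign (pT : predType T) (D : pT) J :
  {in J, forall c, c \notin D} -> indep_of D (parity_sign J).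
Proof. by move=> JD x y /agree_offP xy; apply: eq_big_seq => c /JD /xy ->. Qed.

Lemma parity_sign_toggle (pT : predType T) (D : pT) e c J :
  is_sign e -> c \notin D -> {in J, forall c, c \notin D} ->
  exists K, [/\ (size K <= (size J).+1)%N, {in K, forall c, c \notin D} &
    forall x, parity_sign K x = (if x c then e else 1) * parity_sign J x].
Proof.
move=> [] -> cD JD; first by exists J; split=> // x; rewrite if_same mul1r.
exists (c :: J); split=> // [c'|x]; first by rewrite inE => /orP [/eqP ->|/JD].
by rewrite /parity_sign big_cons; case: (x c).
Qed.

Lemma rotcirc_ctrl_parity_sign b J P : b \notin codom g ->
  {in J, forall c, c \notin codom g} -> is_pauli P ->
  rotcirc (3 * size J + (3 * #|S| + 2))
    (mux g (fun x => if x b then parity_sign J x *: P else 1)).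
Proof.
move=> bg Jg pP; elim: J Jg => [|c J IH] Jg.
  rewrite muln0 (eq_mux g (m' := fun x => if x b then P else 1)) => [|x].
    by rewrite -(ctrlE g_inj bg); apply: rotcirc_ctrl_pauli.
  by rewrite /parity_sign big_nil scale1r.
have cg : c \notin codom g by apply: Jg; rewrite mem_head.
have {}Jg : {in J, forall c, c \notin codom g}.
  by move=> c' cJ; apply: Jg; rewrite inE cJ orbT.
have -> : mux g (fun x => if x b then parity_sign (c :: J) x *: P else 1) =
    eigen_ctrl (pauli_at b letterZ) (pauli_at c letterZ) *
    mux g (fun x => if x b then parity_sign J x *: P else 1).
  have im : indep_of (codom g) (fun x => if x b then parity_sign J x *: P else 1).
    by move=> x y xy; rewrite (indep_of_parity_sign Jg xy) (agree_offP _ _ _ xy).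
  rewrite /eigen_ctrl (mux_pauliZ g_inj bg) (mux_pauliZ g_inj cg) -(mux1 g_inj).
  rewrite -muxN -!muxD -!muxZ muxM //; last first.
    by move=> x y /agree_offP ->.
  rewrite -muxD muxM //; apply: eq_mux => x.
  rewrite /parity_sign big_cons; case: (x b); rewrite ?expr1 ?expr0 ?scaleN1r ?scale1r.
    rewrite subrr scaler0 add0r opprK half_double mul1r.
    by rewrite mulr_algl scalerA.
  by rewrite subrr scaler0 mul0r addr0 half_double mul1r.
rewrite mulnS -addnA; apply: rotcircM; last exact: IH.
by apply: rotcirc_eigen_ctrl; rewrite ?pauli_at_sqr //; try exact: light_pauli_at;
  rewrite -qcomm1P; have := pauli_at_qcomm b c letterZ letterZ; rewrite andbF.
Qed.

End ControlledPaulis.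

(* Conjugation by [V] maps the Pauli [w] with [V P = w P V] to [P^-1 w P] up to
   sign, since [V * V] is a Pauli. *)
Lemma commutator_sign_comm (S : finType) (V P : op S) :
  is_clifford V -> is_pauli (V * V) -> is_pauli P ->
  exists w, [/\ is_pauli w, sign_comm V w & V * P = w * P * V].
Proof.
move=> [uV cV] pVV pP; have pW : is_pauli (conj_by V P) by apply: cV.
have [f sf aP] := pauli_adjE pP.
have [e se VVP] := pauli_sign_comm pVV pP.
have [h sh PW] := pauli_sign_comm pP pW.
exists (conj_by V P * adj P); split; first exact/pauliM/pauli_adj.
  exists (e * h); first exact: is_signM.
  apply: qcomm_conj_byP => //; rewrite conj_byMr // -conj_byMl.
  rewrite (conj_by_qcomm (pauli_unitary pVV) VVP) aP conj_byZ.
  by rewrite scalerMl !scalerMr PW !scalerA mulrAC.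
rewrite -[X in X * V]mulrA unitary_mulVr; last exact: pauli_unitary.
by rewrite mulr1 -mulrA unitary_mulVr ?mulr1.
Qed.

Section BlockPropagation.
Variables (S T : finType) (g : S -> T) (D : {set T}) (V Q : op S).
Hypotheses (g_inj : injective g) (gD : {subset codom g <= D}).
Hypotheses (cV : is_clifford V) (pVV : is_pauli (V * V)).
Hypotheses (pQ : is_pauli Q) (VQ : sign_comm V Q).
Implicit Types (c : T) (J : seq T) (m : basis T -> op S).

Lemma notin_block c : c \notin D -> c \notin codom g.
Proof. by apply: contraNN; apply: gD. Qed.

(* [parity_sign J x] is the sign by which conjugation of [m x] by [V] differs from that
   of the initial error. It remains a character of [x] because every Pauli that commutes
   with [V] up to sign does so with [m x], with a sign independent of [x]. *)
Definition block_error m J : Prop :=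
  [/\ indep_of D m,
      forall z, is_pauli z -> sign_comm V z ->
        exists2 e, is_sign e & forall x, qcomm e (m x) z,
      forall x, conj_by V (m x) = parity_sign J x *: (Q * m x) &
      {in J, forall c, c \notin D}].

Lemma indep_of_conj_if m c A : c \notin D -> indep_of D m ->
  indep_of D (fun x => if x c then conj_by A (m x) else m x).
Proof. by move=> cD im x y xy; rewrite (im _ _ xy) (agree_offP _ _ _ xy). Qed.

Lemma block_error_ctrl_pauli m J c P : block_error m J -> c \notin D -> is_pauli P ->
  exists2 K, (size K <= (size J).+1)%N &
    block_error (fun x => if x c then conj_by P (m x) else m x) K.
Proof.
move=> [im mz mV JD] cD pP; have uP := pauli_unitary pP.
have [w [pw Vw VP]] := commutator_sign_comm cV pVV pP.
have [d sd mw] := mz w pw Vw.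
have [e se PQ] := pauli_sign_comm (pauliM pw pP) pQ.
have [K [sK KD KE]] := parity_sign_toggle (is_signM se sd) cD JD.
have mPz z f : is_pauli z -> (forall x, qcomm f (m x) z) ->
    forall x, qcomm f (conj_by P (m x)) z.
  move=> pz mfz x; have [h sh Ph] := pauli_sign_comm pP pz.
  exact: qcomm_conj_byl Ph (mfz x).
exists K => //; split=> // [|z pz Vz|x]; first exact: indep_of_conj_if.
  have [f sf mfz] := mz z pz Vz; exists f => // x.
  by case: (x c) => //; apply: mPz.
rewrite KE; case: (x c); last by rewrite mul1r.
have uwP : is_unitary (w * P) := pauli_unitary (pauliM pw pP).
rewrite -conj_byMl VP conj_byMl mV conj_byZ conj_byMr // (conj_by_qcomm uwP PQ).
rewrite conj_byMl (conj_by_qcomm (pauli_unitary pw) (qcomm_sym sd (mPz w d pw mw x))).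
by rewrite scalerMl scalerMr !scalerA mulrC.
Qed.

Lemma block_error_ctrl_self m J c : block_error m J -> c \notin D ->
  exists2 K, (size K <= (size J).+1)%N &
    block_error (fun x => if x c then conj_by V (m x) else m x) K.
Proof.
move=> [im mz mV JD] cD; have [e se Ve] := VQ.
have [K [sK KD KE]] := parity_sign_toggle se cD JD.
exists K => //; split=> // [|z pz Vz|x]; first exact: indep_of_conj_if.
  have [f sf mfz] := mz z pz Vz; have [h sh Vh] := Vz; exists f => // x.
  by case: (x c) => //; apply: qcomm_conj_byl Vh (mfz x); case: cV.
rewrite KE; case: (x c); last by rewrite mul1r.
rewrite {1}mV conj_byZ conj_byMr ?(conj_by_qcomm cV.1 Ve); try by case: cV.
by rewrite scalerMl scalerA mulrC.
Qed.

Lemma block_correction m J c : block_error m J ->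
  mux g (fun x => if x c then conj_by V (m x) else m x) =
  mux g (fun x => if x c then parity_sign J x *: Q else 1) * mux g m.
Proof.
move=> [im _ mV _]; rewrite muxM //; last exact: indep_of_sub gD im.
by apply: eq_mux => x; case: (x c); rewrite ?mul1r // mV scalerMl.
Qed.

End BlockPropagation.

Section BlockGates.
Variables (S T : finType) (g : S -> T) (D : {set T}) (V : op S).
Hypotheses (g_inj : injective g) (gD : {subset codom g <= D}).
Hypotheses (cV : is_clifford V) (pVV : is_pauli (V * V)).
Implicit Types (c : T) (J : seq T) (m : basis T -> op S).

(* The booleans tell whether the gate is a controlled Pauli, resp. a controlled [V],
   on the block. *)
Variant block_gate (G : op T) : bool -> bool -> Prop :=
  | PauliBlockGate c s e of c \notin D & G = ctrl c g (pauli_at s e) :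
      block_gate G true false
  | SelfBlockGate c of c \notin D & G = ctrl c g V : block_gate G false true
  | OffBlockGate of is_unitary G &
      (forall m, indep_of D m -> GRing.comm G (mux g m)) : block_gate G false false.

Lemma ctrl_off_block (S' : finType) (g' : S' -> T) c A :
  injective g' -> {subset codom g' <= D} -> (forall s s', g s != g' s') ->
  c \notin D -> is_unitary A -> block_gate (ctrl c g' A) false false.
Proof.
move=> gi' gD' disj cD uA; constructor.
  by apply: ctrl_unitary => //; apply: contraNN cD => /gD'.
by move=> m; apply: comm_ctrl_mux disj cD.
Qed.

Variables (L : Type) (gate : L -> op T) (isP isV : pred L).
Hypothesis gateP : forall l, block_gate (gate l) (isP l) (isV l).

Lemma block_propagation Q m J n s : is_pauli Q -> sign_comm V Q ->
  block_error D V Q m J -> rotcirc n (mux g m) ->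
  rotcirc (n + 6 * count isP s +
      count isV s * (3 * (size J + count isP s + count isV s) + 3 * #|S| + 2))
    (conj_by (circ (map gate s)) (mux g m)).
Proof.
move=> pQ VQ; elim: s m J n => [|l s IH] m J n err rm.
  by rewrite conj_by1 muln0 !addn0.
have [im _ _ JD] := err; have im_g := indep_of_sub gD im.
rewrite [map _ _]/= circ_cons conj_byMl [count isP _]/= [count isV _]/=.
case: (gateP l) => [c t e cD ->|c cD ->|uG comm].
- have cg := notin_block gD cD; have pP := pauli_at_pauli t e.
  have [K sK err'] := block_error_ctrl_pauli cV pVV pQ err cD pP.
  have := rotcirc_conj (rotcirc_ctrl_pauli_at g_inj t e cg) rm.
  rewrite conj_by_ctrl // => rm'; apply: rotcirc_le (IH _ _ _ err' rm').
  by nia.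
- have cg := notin_block gD cD; have [K sK err'] := block_error_ctrl_self cV VQ err cD.
  have rQ := rotcirc_ctrl_parity_sign g_inj cg (fun c cJ => notin_block gD (JD c cJ)) pQ.
  have := rotcircM rQ rm; rewrite -(block_correction g_inj gD _ err) => rm'.
  rewrite conj_by_ctrl //; apply: rotcirc_le (IH _ _ _ err' rm').
  by nia.
by rewrite (conj_by_comm uG (comm _ im)); apply: IH err rm.
Qed.

Definition block_cost k p v : nat := 6 * p + v * (3 * (p + v) + 3 * k + 2).

Lemma block_pauli_error E s : is_pauli E -> rotcirc 2 E ->
  rotcirc (2 + block_cost #|S| (count isP s) (count isV s))
    (conj_by (circ (map gate s)) (embed g E)).
Proof.
move=> pE rE; have [w [pw Vw VE]] := commutator_sign_comm cV pVV pE.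
have err : block_error D V w (fun=> E) [::].
  split=> // [z pz _|x]; first by have [e se Ez] := pauli_sign_comm pE pz; exists e.
  rewrite /parity_sign big_nil scale1r /conj_by VE -mulrA unitary_mulrV ?mulr1 //.
  by case: cV.
rewrite /block_cost addnA embedE; apply: block_propagation pw Vw err _.
by rewrite -embedE; apply: rotcirc_embed.
Qed.

Lemma block_self_error c s : c \notin D ->
  rotcirc (clifford_cost #|S| + (3 * #|S| + 2) +
      block_cost #|S| (count isP s) (count isV s))
    (conj_by (circ (map gate s)) (mux g (fun x => if x c then adj V else V))).
Proof.
move=> cD; have uV := cV.1; have cg := notin_block gD cD.
have V1 : sign_comm V 1 by exists 1; [exact: is_sign1 | rewrite qcomm1P; apply: commr1].
have err : block_error D V 1 (fun x => if x c then adj V else V) [::].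
  split=> // [x y /agree_offP -> //|z pz [e se Vz]|x].
    by exists e => // x; case: (x c) => //; apply: qcomm_adj.
  rewrite /parity_sign big_nil scale1r mul1r; apply: conj_by_comm => //.
  by case: (x c); rewrite // /GRing.comm unitary_mulrV // unitary_mulVr.
rewrite /block_cost addnA; apply: block_propagation (pauli1 S) V1 err _.
have -> : mux g (fun x => if x c then adj V else V) =
    embed g V * ctrl c g (adj V * adj V).
  rewrite embedE ctrlE // muxM //; last exact: indep_of_ctrl.
  by apply: eq_mux => x; case: (x c); rewrite ?mulr1 // mulrA unitary_mulrV // mul1r.
apply: rotcircM; first by apply: rotcirc_embed => //; apply: clifford_rotcirc.
by apply: rotcirc_ctrl_pauli => //; rewrite -adjM; apply: pauli_adj.
Qed.

End BlockGates.

Lemma conj_by_spread (T : finType) (L : Type) (gate : L -> op T) (isC : pred L)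
    (F : L -> op T) E n C s :
  rotcirc n E -> (forall l, is_unitary (gate l)) ->
  (forall l, conj_by (gate l) E = E \/ isC l /\ conj_by (gate l) E = E * F l) ->
  (forall s1 l s2, s = s1 ++ l :: s2 -> isC l ->
    rotcirc C (conj_by (circ (map gate s2)) (F l))) ->
  rotcirc (n + count isC s * C) (conj_by (circ (map gate s)) E).
Proof.
move=> rE ugate gateE; elim: s => [|l s IH] rF; first by rewrite conj_by1 addn0.
have {}IH : rotcirc (n + count isC s * C) (conj_by (circ (map gate s)) E).
  by apply: IH => s1 l' s2 ss; apply: (rF (l :: s1)); rewrite ss.
rewrite [map _ _]/= circ_cons conj_byMl; case: (gateE l) => [->|[Cl ->]].
  by apply: rotcirc_le IH => /=; nia.
rewrite conj_byMr; last exact: circ_unitary.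
apply: rotcirc_le (rotcircM IH (rF [::] l s erefl Cl)).
by rewrite /= Cl; nia.
Qed.

(** * Gates of a protocol *)

Lemma uniq_flatten_map (A B : eqType) (f : A -> seq B) (h : B -> A) s : uniq s ->
  (forall x, uniq (f x)) -> (forall x y, y \in f x -> h y = x) ->
  uniq (flatten (map f s)).
Proof.
move=> + fu fh; elim: s => //= x s IH /andP [xs /IH us].
rewrite cat_uniq fu us andbT /=; apply/hasPn => y /flatten_mapP [x' x's yx'].
by apply: contraNN xs => /fh <-; rewrite (fh _ _ yx').
Qed.

Section GateLabels.
Variable P : protocol.

Definition gate_label : finType :=
  (stab_anc P * 'I_(pn P) + psc_anc P * 'I_(pl P))%type.
Implicit Types (l : gate_label) (L : seq gate_label) (t : 'I_(pr P)).

Definition label_round l : 'I_(pr P) :=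
  match l with inl (a, _) => (val a).1 | inr (a, _) => val a end.

Definition label_ctrl l : qubit P :=
  match l with inl (a, _) => inl (inr a) | inr (a, _) => inr a end.

Definition label_gate l : op (qubit P) :=
  match l with
  | inl (a, j) => ctrl (inl (inr a) : qubit P) (fun _ : 'I_1 => data j)
                       (sigma1 (pP (val a).2 j))
  | inr (a, i) => ctrl (inr a : qubit P) (fun q => data (pf i q)) (pV i)
  end.

Definition stab_labels t : seq (stab_anc P * 'I_(pn P)) :=
  pmap (fun ij : 'I_(pm P) * 'I_(pn P) =>
    omap (fun a : stab_anc P => (a, ij.2)) (insub (t, ij.1))) (psched t).

Definition psc_labels t : seq (psc_anc P * 'I_(pl P)) :=
  if insub t is Some a then [seq (a, i) | i <- plsched t] else [::].

Definition round_labels t : seq gate_label :=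
  if prk t then map inl (stab_labels t) else map inr (psc_labels t).

Definition labels : seq gate_label :=
  flatten [seq round_labels t | t <- enum 'I_(pr P)].

Lemma gates_labels : gates P = map label_gate labels.
Proof.
rewrite /gates /labels map_flatten -map_comp; congr flatten; apply: eq_map => t /=.
rewrite /round_gates /round_labels; case: (prk t); rewrite -map_comp.
  rewrite /stab_round_gates /stab_labels.
  elim: (psched t) => //= [[i j] s IH]; case: insubP => [a _ av|_] /=; last exact: IH.
  by rewrite IH av.
rewrite /psc_round_gates /psc_labels; case: insubP => [a _ _|_] //.
by rewrite -map_comp.
Qed.

Definition active l : bool := if l is inl (a, j) then Hmx (val a).2 j else true.

Definition legal L : bool := uniq L && all active L.

Lemma legal_subseq L L' : subseq L' L -> legal L -> legal L'.
Proof.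
move=> sub /andP [uL aL]; apply/andP; split; first exact: subseq_uniq uL.
by apply/allP => l /(mem_subseq sub); apply: allP.
Qed.

Lemma mem_stab_labels t u : u \in stab_labels t ->
  (val u.1).1 = t /\ ((val u.1).2, u.2) \in psched t.
Proof.
rewrite mem_pmap => /mapP [[i j] ij] /=.
by case: insubP => [a _ av|] //= [->]; rewrite av.
Qed.

Lemma uniq_stab_labels t : uniq (psched t) -> uniq (stab_labels t).
Proof.
apply: (@pmap_uniq _ _ _ (fun u : stab_anc P * 'I_(pn P) => ((val u.1).2, u.2))).
by move=> [i j] /=; case: insubP => [a _ av|] //=; rewrite av.
Qed.

Lemma uniq_psc_labels t : uniq (plsched t) -> uniq (psc_labels t).
Proof.
by rewrite /psc_labels; case: insub => [a|] //; rewrite map_inj_uniq // => i j [].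
Qed.

Lemma mem_round_labels t l : l \in round_labels t -> label_round l = t.
Proof.
rewrite /round_labels; case: ifP => _ /mapP [[a i] + ->].
  by case/mem_stab_labels.
by rewrite /psc_labels; case: insubP => [b _ <-|] // /mapP [i' _ [-> _]].
Qed.

Lemma legal_labels s : valid_protocol P s -> legal labels.
Proof.
move=> [sched lsched _ _ _]; apply/andP; split; last first.
  apply/allP => l /flatten_mapP [t _]; rewrite /round_labels.
  case: ifP => stab_t /mapP [u + ->] //; case: u => a j /mem_stab_labels [_].
  by rewrite (perm_mem (sched t stab_t)) mem_filter => /andP [].
apply: (uniq_flatten_map (h := label_round)) mem_round_labels => [|t].
  exact: enum_uniq.
rewrite /round_labels; case: ifPn => kind_t.
  rewrite map_inj_uniq => [|u u' []//]; apply: uniq_stab_labels.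
  by rewrite (perm_uniq (sched t kind_t)) filter_uniq ?enum_uniq.
rewrite map_inj_uniq => [|u u' []//]; apply: uniq_psc_labels.
by rewrite (perm_uniq (lsched t kind_t)) enum_uniq.
Qed.

Lemma count_legal (p : pred gate_label) L : legal L ->
  (count p L <= #|[set l | p l & active l]|)%N.
Proof.
move=> /andP [uL /allP aL]; rewrite -size_filter -(card_uniqP (filter_uniq p uL)).
by apply/subset_leq_card/subsetP => l; rewrite mem_filter inE => /andP [-> /aL].
Qed.

Definition touches k (g : 'I_k -> 'I_(pn P)) l : bool :=
  if l is inl (_, j) then j \in codom g else false.

Definition invokes (v : pred 'I_(pl P)) l : bool :=
  if l is inr (_, i) then v i else false.

Definition ctrl_by (q : qubit P) l : bool := label_ctrl l == q.

Definition touching_pairs k (g : 'I_k -> 'I_(pn P)) : {set 'I_(pn P) * 'I_(pm P)} :=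
  [set ji | (ji.1 \in codom g) && Hmx ji.2 ji.1].

Lemma card_touching_pairs k (g : 'I_k -> 'I_(pn P)) : (#|touching_pairs g| <= k * wq P)%N.
Proof.
rewrite -sum1dep_card.
rewrite -(pair_big_dep (mem (codom g)) (fun j i => Hmx i j) (fun _ _ => 1%N)) /=.
apply: (@leq_trans (\sum_(j in codom g) wq P)).
  apply: leq_sum => j _; rewrite sum1dep_card.
  exact: (leq_bigmax (F := fun j => #|[set i | Hmx i j]|) j).
rewrite sum_nat_const leq_mul2r; apply/orP; right.
by apply: leq_trans (card_size _) _; rewrite size_codom card_ord.
Qed.

Lemma count_touches k (g : 'I_k -> 'I_(pn P)) L : legal L ->
  (count (touches g) L <= pr P * (k * wq P))%N.
Proof.
move=> /count_legal cL; apply: leq_trans (cL _) _.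
pose B := [set u : stab_anc P * 'I_(pn P) | (u.2 \in codom g) && Hmx (val u.1).2 u.2].
apply: (@leq_trans #|B|).
  apply: leq_trans (leq_imset_card inl _); apply/subset_leq_card/subsetP => l.
  rewrite inE; case: l => // u; case: u => a j /= aj.
  by apply/imsetP; exists (a, j); rewrite // inE.
pose h (u : stab_anc P * 'I_(pn P)) := ((val u.1).1, (u.2, (val u.1).2)).
have h_inj : injective h.
  move=> [a j] [b j'] [ab1 -> ab2]; congr (_, _); apply: val_inj.
  by rewrite /= (surjective_pairing (val a)) ab1 ab2 -surjective_pairing.
rewrite -(card_imset _ h_inj).
apply: (@leq_trans #|setX [set: 'I_(pr P)] (touching_pairs g)|).
  by apply/subset_leq_card/subsetP => _ /imsetP [u uB ->]; rewrite !inE in uB *.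
by rewrite cardsX cardsT card_ord leq_mul2l card_touching_pairs orbT.
Qed.

Lemma count_invokes (v : pred 'I_(pl P)) L : legal L ->
  (count (invokes v) L <= pr P * #|v|)%N.
Proof.
move=> /count_legal cL; apply: leq_trans (cL _) _.
pose B := [set u : psc_anc P * 'I_(pl P) | v u.2].
apply: (@leq_trans #|B|).
  apply: leq_trans (leq_imset_card inr _); apply/subset_leq_card/subsetP => l.
  rewrite inE; case: l => // u; case: u => a i; rewrite andbT /= => vi.
  by apply/imsetP; exists (a, i); rewrite // inE.
pose h (u : psc_anc P * 'I_(pl P)) := (val u.1, u.2).
have h_inj : injective h by move=> [a i] [b i'] /= [/val_inj -> ->].
rewrite -(card_imset _ h_inj).
apply: (@leq_trans #|setX [set: 'I_(pr P)] [set i | v i]|).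
  by apply/subset_leq_card/subsetP => _ /imsetP [u uB ->]; rewrite !inE in uB *.
by rewrite cardsX cardsT card_ord cardsE.
Qed.

Lemma count_ctrl_by q L : legal L -> (count (ctrl_by q) L <= wc P + pl P)%N.
Proof.
move=> /count_legal cL; apply: leq_trans (cL _) _; case: q => [[j|a]|a].
- rewrite (_ : [set l | _ & _] = set0) ?cards0 //; apply/setP => l.
  by rewrite !inE; case: l => -[].
- apply: leq_trans (leq_addr _ _).
  apply: leq_trans (leq_bigmax (F := fun i => #|[set j | Hmx i j]|) (val a).2).
  apply: leq_trans (leq_imset_card (fun j => inl (a, j) : gate_label) _).
  apply/subset_leq_card/subsetP => l; rewrite inE => /andP [/eqP].
  case: l => -[b j] //= [->] Hbj; apply/imsetP; exists j => //.
  by rewrite inE.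
- apply: leq_trans (leq_addl _ _); rewrite -[X in (_ <= X)%N]card_ord.
  apply: leq_trans (leq_imset_card (fun i => inr (a, i) : gate_label) _).
  apply/subset_leq_card/subsetP => l; rewrite inE => /andP [/eqP].
  by case: l => -[b i] //= [->] _; apply: imset_f.
Qed.

End GateLabels.

(** * Errors in a protocol *)

Section DataQubits.
Variable P : protocol.

Definition data_qubits : {set qubit P} := [set data j | j : 'I_(pn P)].

Lemma data_inj : injective (@data P). Proof. by move=> i j []. Qed.

Lemma label_ctrl_data l : @label_ctrl P l \notin data_qubits.
Proof. by apply/imsetP => -[j _]; case: l => -[]. Qed.

Lemma codom_data (S : finType) (g : S -> 'I_(pn P)) :
  {subset codom (fun s => data (g s)) <= data_qubits}.
Proof. by move=> _ /codomP [s ->]; apply: imset_f. Qed.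

End DataQubits.

Lemma sigma1E e : sigma1 e = pauli_at ord0 e.
Proof.
by apply: opP => x y; rewrite /pauli_at pauli_tensorE mul1r big_ord1 /site_letter eqxx.
Qed.

Lemma sigma1_unitary e : is_unitary (sigma1 e).
Proof. by rewrite sigma1E; apply/pauli_unitary/pauli_at_pauli. Qed.

Lemma wc_gt0 P : (0 < wq P)%N -> (0 < wc P)%N.
Proof.
move=> wq_gt0; have [j] : exists j, (0 < #|[set i | @Hmx P i j]|)%N.
  apply/existsP; apply: contraTT wq_gt0; rewrite negb_exists -leqNgt => /forallP Hj.
  by apply/bigmax_leqP => j _; rewrite leqNgt.
move=> /card_gt0P [i]; rewrite inE => Hij.
apply: leq_trans (leq_bigmax (F := fun i => #|[set j | Hmx i j]|) i).
by apply/card_gt0P; exists j; rewrite inE.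
Qed.

Definition block_scale (P : protocol) : nat := pr P ^ 2 * wq P.

Definition block_factor (s : nat) : nat := 12 * s.+1 + 5.

Definition branch_cost (s : nat) : nat :=
  clifford_cost s.+1 + (3 * s.+1 + 2) + block_factor s.

Section ProtocolErrors.
Variables (P : protocol) (s : nat).
Hypothesis vP : valid_protocol P s.
Hypotheses (r_gt0 : (0 < pr P)%N) (wq_gt0 : (0 < wq P)%N).
Implicit Types (l : gate_label P) (L : seq (gate_label P)).

Lemma pf_inj i : injective (@pf P i).
Proof. by case: vP => _ _ /(_ i) []. Qed.

Lemma pV_clifford i : is_clifford (@pV P i).
Proof. by case: vP => _ _ /(_ i) [_ []]. Qed.

Lemma pV_sqr_pauli i : is_pauli (@pV P i * pV i).
Proof. by case: vP => _ _ /(_ i) [_ [_ []]]. Qed.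

Lemma pk_le i : (@pk P i <= s)%N.
Proof. by case: vP => _ _ /(_ i) []. Qed.

Lemma pf_disjoint i i' a b : i != i' -> @pf P i a != pf i' b.
Proof. by case: vP => _ _ _ + _; apply. Qed.

Lemma data_pf_inj i : injective (fun q => data (@pf P i q)).
Proof. by move=> a b /data_inj/pf_inj. Qed.

Lemma label_gate_unitary l : is_unitary (label_gate l).
Proof.
have cD := label_ctrl_data l; case: l cD => -[a j] cD /=.
  apply: ctrl_unitary (sigma1_unitary _); first exact: const_ord1_inj.
  exact: (notin_block (@codom_data _ _ _)).
apply: ctrl_unitary (pV_clifford j).1; first exact: data_pf_inj.
exact: (notin_block (@codom_data _ _ _)).
Qed.

(* A block of data qubits: the support of some [V_i], or a qubit outside all of them,
   for which [V = 1] and no gate is of the second kind. *)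
Definition is_block k (g : 'I_k -> 'I_(pn P)) (V : op 'I_k) (v : pred 'I_(pl P)) : Prop :=
  [/\ (k <= s.+1)%N /\ (#|v| <= 1)%N, injective g, is_clifford V, is_pauli (V * V) &
    forall l, block_gate (fun q => data (g q)) (data_qubits P) V (label_gate l)
                (touches g l) (invokes v l)].

Lemma stab_gate_on_block k (g : 'I_k -> 'I_(pn P)) (V : op 'I_k) a j : injective g ->
  block_gate (fun q => data (g q)) (data_qubits P) V (label_gate (inl (a, j)))
    (j \in codom g) false.
Proof.
move=> gi; have dgi : injective (fun q => data (g q)) by move=> x y /data_inj/gi.
have cD : inl (inr a) \notin data_qubits P := label_ctrl_data (inl (a, j)).
have gD := @codom_data P _ g; have ji := @const_ord1_inj _ (@data P j).
have jD := @codom_data P _ (fun _ : 'I_1 => j).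
have [/codomP [q jq]|jg] := boolP (j \in codom g).
  apply: (PauliBlockGate _ (s := q) (e := pP (val a).2 j) cD).
  rewrite /= sigma1E -(eigen_ctrl_embed ji) ?(notin_block jD) //.
  rewrite -(eigen_ctrl_embed dgi) ?(notin_block gD) //.
  by rewrite (embed_pauli_at ji) (embed_pauli_at dgi) -jq.
apply: (ctrl_off_block V dgi gD) => //; last exact: sigma1_unitary.
by move=> q _; apply: contraNneq jg => /data_inj <-; apply: codom_f.
Qed.

Lemma psc_gate_off_block k (g : 'I_k -> 'I_(pn P)) (V : op 'I_k) a i : injective g ->
  (forall q q', g q != pf i q') ->
  block_gate (fun q => data (g q)) (data_qubits P) V (label_gate (inr (a, i)))
    false false.
Proof.
move=> gi disj; have dgi : injective (fun q => data (g q)) by move=> x y /data_inj/gi.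
have cD : inr a \notin data_qubits P := label_ctrl_data (inr (a, i)).
apply: (ctrl_off_block V dgi (@codom_data P _ g) (@data_pf_inj i)) => //.
  exact: codom_data.
exact: (pV_clifford i).1.
Qed.

Lemma psc_is_block i : is_block (@pf P i) (pV i) (pred1 i).
Proof.
split; first by rewrite card1 (leqW (pk_le i)).
- exact: pf_inj.
- exact: pV_clifford.
- exact: pV_sqr_pauli.
case=> -[a j]; first exact/stab_gate_on_block/pf_inj.
rewrite [touches _ _]/= [invokes _ _]/=; have [->|ji] := eqVneq j i.
  exact: SelfBlockGate (label_ctrl_data (inr (a, i))) _.
apply: psc_gate_off_block => [|q q']; first exact: pf_inj.
by apply: pf_disjoint; rewrite eq_sym.
Qed.

Lemma free_is_block j : (forall i q, @pf P i q != j) ->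
  is_block (fun _ : 'I_1 => j) 1 pred0.
Proof.
move=> free; split; first by rewrite card0.
- exact: const_ord1_inj.
- exact/pauli_clifford/pauli1.
- by rewrite mulr1; apply: pauli1.
case=> -[a i]; first exact/stab_gate_on_block/const_ord1_inj.
apply: psc_gate_off_block => [|q q']; first exact: const_ord1_inj.
by rewrite eq_sym.
Qed.

Lemma data_qubit_in_block (j : 'I_(pn P)) :
  exists k (g : 'I_k -> 'I_(pn P)) V v q, is_block g V v /\ g q = j.
Proof.
have [i /codomP [q jq]|free] := pickP (fun i => j \in codom (@pf P i)).
  by exists (pk i), (pf i), (pV i), (pred1 i), q; split=> //; apply: psc_is_block.
exists 1%N, (fun=> j), 1, pred0, ord0; split=> //; apply: free_is_block => i q.
by apply: contraFneq (free i) => <-; apply: codom_f.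
Qed.

Lemma block_scale_gt0 : (0 < block_scale P)%N.
Proof. by rewrite muln_gt0 expn_gt0 r_gt0. Qed.

Lemma block_cost_le k p v : (k <= s.+1)%N -> (p <= pr P * (k * wq P))%N ->
  (v <= pr P)%N -> (block_cost k p v <= block_factor s * block_scale P)%N.
Proof.
move=> ks pr_le vr.
have rw : (pr P * wq P <= block_scale P)%N by rewrite /block_scale expnS expn1; nia.
have rr : (pr P * pr P <= block_scale P)%N by rewrite /block_scale expnS expn1; nia.
have r1 : (pr P <= block_scale P)%N by apply: leq_trans rr; apply: leq_pmulr.
have p_le : (p <= s.+1 * block_scale P)%N by nia.
have vp_le : (v * p <= s.+1 * block_scale P)%N.
  apply: leq_trans (leq_mul vr pr_le) _.
  have -> : (pr P * (pr P * (k * wq P)) = k * block_scale P)%N.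
    by rewrite /block_scale; ring.
  by rewrite leq_mul2r ks orbT.
have vv_le : (v * v <= block_scale P)%N := leq_trans (leq_mul vr vr) rr.
have vk_le : (v * k <= s.+1 * block_scale P)%N.
  by rewrite mulnC; apply: leq_mul => //; apply: leq_trans r1.
rewrite /block_cost; have -> : (v * (3 * (p + v) + 3 * k + 2) =
  3 * (v * p) + 3 * (v * v) + 3 * (v * k) + 2 * v)%N by ring.
by rewrite /block_factor mulnDl -mulnA; lia.
Qed.

Lemma block_cost_legal k (g : 'I_k -> 'I_(pn P)) V v L : is_block g V v -> legal L ->
  (block_cost #|'I_k| (count (touches g) L) (count (invokes v) L) <=
   block_factor s * block_scale P)%N.
Proof.
move=> [[ks v1] _ _ _ _] legL; rewrite card_ord; apply: block_cost_le ks _ _.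
  exact: count_touches.
by apply: leq_trans (count_invokes v legL) _; rewrite -[leqRHS]muln1 leq_mul2l v1 orbT.
Qed.

Lemma data_error_propagation j c e L : c ^+ 4 = 1 -> legal L ->
  rotcirc (2 + block_factor s * block_scale P)
    (conj_by (circ (map (@label_gate P) L)) (c *: pauli_at (data j) e)).
Proof.
move=> c4 legL; have [k [g [V [v [q [blk <-]]]]]] := data_qubit_in_block j.
have [_ gi cV pVV gateP] := blk.
have dgi : injective (fun q => data (g q)) by move=> x y /data_inj/gi.
have lE : light_pauli 1 (c *: pauli_at q e) by apply: light_pauliZ (light_pauli_at _ _).
rewrite -(embed_pauli_at dgi) -embedZ.
apply: rotcirc_le (block_pauli_error dgi (@codom_data P _ g) cV pVV gateP L
  (light_is_pauli lE) (rotcirc_light_pauli (light_pauli_le _ lE))) => //.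
by rewrite leq_add2l; apply: block_cost_legal blk legL.
Qed.

Lemma psc_error_propagation i c L : c \notin data_qubits P -> legal L ->
  rotcirc (clifford_cost s.+1 + (3 * s.+1 + 2) + block_factor s * block_scale P)
    (conj_by (circ (map (@label_gate P) L))
      (mux (fun q => data (pf i q)) (fun x => if x c then adj (pV i) else pV i))).
Proof.
move=> cD legL; have blk := psc_is_block i; have [[ks _] _ cV pVV gateP] := blk.
apply: rotcirc_le
  (block_self_error (@data_pf_inj i) (@codom_data P _ _) cV pVV gateP L cD).
apply: leq_add (block_cost_legal blk legL); rewrite card_ord.
apply: leq_add; first exact: clifford_cost_le.
by rewrite leq_add2r leq_mul2l.
Qed.

Definition residual_error l : op (qubit P) :=
  match l with
  | inl (a, j) => pauli_at (data j) (pP (val a).2 j)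
  | inr (a, i) => mux (fun q => data (pf i q))
                    (fun x => if x (inr a) then adj (pV i) else pV i)
  end.

Lemma conj_by_label_gate q k e l : q \notin data_qubits P ->
  let E := k *: pauli_at q e in
  conj_by (label_gate l) E = E \/
  ctrl_by q l /\ conj_by (label_gate l) E = E * residual_error l.
Proof.
move=> qD E; have cD := label_ctrl_data l.
have off (S : finType) (g : S -> 'I_(pn P)) c : c \notin data_qubits P ->
    c \notin codom (fun s => data (g s)) by apply/notin_block/codom_data.
case: l cD => -[b j] cD.
  have ji := @const_ord1_inj _ (@data P j).
  have [->|[cq]] := conj_by_ctrl_pauli_at ji (off _ (fun _ : 'I_1 => j) _ cD) k e
    (sigma1_unitary (pP (val b).2 j)) (off _ (fun _ : 'I_1 => j) _ qD); first by left.
  rewrite [label_gate _]/= => ->; right; split; first exact/eqP.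
  congr (_ * _); rewrite /= -(embed_pauli_at ji ord0) embedE.
  by apply: eq_mux => x; rewrite sigma1E pauli_at_adj if_same.
have [->|[cq]] := conj_by_ctrl_pauli_at (@data_pf_inj j) (off _ _ _ cD) k e
  (pV_clifford j).1 (off _ _ _ qD); first by left.
by rewrite [label_gate _]/= => ->; right; split; first exact/eqP.
Qed.

Lemma residual_error_propagation l L : legal L ->
  rotcirc (branch_cost s * block_scale P)
    (conj_by (circ (map (@label_gate P) L)) (residual_error l)).
Proof.
move=> legL; have V0 := block_scale_gt0; case: l => -[a j] /=.
  rewrite -[pauli_at _ _]scale1r.
  apply: rotcirc_le (data_error_propagation j _ (expr1n _ 4) legL).
  by rewrite /branch_cost [leqRHS]mulnDl leq_add2r; nia.
apply: rotcirc_le (psc_error_propagation j (label_ctrl_data (inr (a, j))) legL).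
by rewrite /branch_cost [leqRHS]mulnDl leq_add2r leq_pmulr.
Qed.

Lemma error_propagation q c e L : c ^+ 4 = 1 -> legal L ->
  rotcirc (2 + (wc P + pl P) * (branch_cost s * block_scale P))
    (conj_by (circ (map (@label_gate P) L)) (c *: pauli_at q e)).
Proof.
move=> c4 legL; have [/imsetP [j _ ->]|qD] := boolP (q \in data_qubits P).
  apply: rotcirc_le (data_error_propagation j e c4 legL); rewrite leq_add2l.
  apply: (@leq_trans (branch_cost s * block_scale P)).
    by rewrite leq_mul2r leq_addl orbT.
  by apply: leq_pmull; rewrite addn_gt0 wc_gt0.
have lE : light_pauli 2 (c *: pauli_at q e).
  exact/(light_pauliZ c4)/(light_pauli_le _ (light_pauli_at _ _)).
apply: rotcirc_le (conj_by_spread (C := branch_cost s * block_scale P)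
  (rotcirc_light_pauli lE) label_gate_unitary
  (fun l => conj_by_label_gate c e l qD) _) => [|L1 l L2 LE _].
  by rewrite leq_add2l leq_mul2r count_ctrl_by ?orbT.
apply: residual_error_propagation; apply: legal_subseq legL.
by rewrite LE -cat_rcons; apply: suffix_subseq.
Qed.

End ProtocolErrors.

Theorem theorem2 :
  forall s : nat, exists K : nat,
  forall P : protocol, valid_protocol P s ->
  (0 < pr P)%N -> (0 < wq P)%N ->
  forall (loc : nat) (E : op (qubit P)),
    (loc <= size (gates P))%N -> single_qubit_pauli E ->
    let W2 := circ (drop loc (gates P)) in
    exists gs : seq (op (qubit P)),
      [/\ all_prop (@small_clifford_gate _) gs,
          (size gs <= K * ((pr P) ^ 2 * wq P * (wc P + pl P)))%N &
          mulop (mulop W2 E) (adj W2) = circ gs].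
Proof.
move=> s; exists (branch_cost s + 3)%N.
move=> P vP r_gt0 wq_gt0 loc E _ [c [q [e [c4 ->]]]] W2.
have WE : W2 = circ (map (@label_gate P) (drop loc (labels P))).
  by rewrite map_drop -gates_labels.
rewrite !mulopE -/(conj_by W2 _) WE -/(site_letter q e) -[c]mulr1 -pauli_tensorZ.
have legL : legal (drop loc (labels P)).
  exact: legal_subseq (drop_subseq _ _) (legal_labels vP).
have [gs [small_gs size_gs ->]] :=
  rotcirc_small_gates q (error_propagation vP r_gt0 wq_gt0 q e c4 legL).
exists gs; split=> //; apply: leq_trans size_gs _.
have : (0 < block_scale P * (wc P + pl P))%N.
  by rewrite muln_gt0 block_scale_gt0 // addn_gt0 wc_gt0.
by rewrite -/(block_scale P); nia.
Qed.
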